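(* Let $\delta_1,\delta_2,\delta_3,\ldots\ge 2$ be a sequence of integers, let $T_0,T_1,T_2,\ldots$ be an associated sequence of finite trees, and let $(\mathcal T,\omega)$ be the Benjamini-Schramm limit of the sequence $(T_n,o_n)$, where $o_n$ is a uniformly random vertex of $T_n$. (i) If $\sum_n\delta_n^{-1}<\infty$ (the sequence is fast-growing), then $(\mathcal T,\omega)$ is almost surely an apocentric limit. (ii) If $\sum_n\delta_n^{-1}=\infty$ (the sequence is slow-growing), then $(\mathcal T,\omega)$ is almost surely a mixed limit, and for every particular deterministic tree the probability that $\mathcal T$ is isomorphic to it is zero. In both cases $(\mathcal T,\omega)$ is almost surely 1-ended.
   Context: Construction of $T_n$. Let $\delta_1,\delta_2,\ldots\ge 1$ be integers. The finite trees $T_n$, $n\ge 0$, each with a distinguished center and a distinguished set of apocentric vertices, are defined recursively. $T_0$ is a single vertex, which is both its center and its only apocentric vertex. For $n\ge1$, $T_n$ is built from $\delta_n+1$ disjoint copies $\tau_0,\tau_1,\ldots,\tau_{\delta_n}$ of $T_{n-1}$ by adding, for each $i\in\{1,\ldots,\delta_n\}$, one edge between the center of $\tau_i$ and some apocentric vertex of $\tau_0$ (the same apocentric vertex of $\tau_0$ may be used several times), subject to the maximal uniformity condition below. The center of $T_n$ is the center of $\tau_0$; the apocentric vertices of $T_n$ are the apocentric vertices of $\tau_1,\ldots,\tau_{\delta_n}$. The copy $\tau_0$ is called the central copy, and $\tau_1,\ldots,\tau_{\delta_n}$ the apocentric copies, of $T_{n-1}$ in $T_n$. Canonical copies. $T_n$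 is the only canonical copy of $T_n$ in itself; for $m<n$ the canonical copies of $T_m$ in $T_n$ are the canonical copies of $T_m$ in $\tau_0,\ldots,\tau_{\delta_n}$. Write $\tau\prec_m T_n$ if $\tau$ is a canonical copy of $T_m$ in $T_n$ (and likewise for trees isomorphic to $T_n$). Such a copy is apocentric if it contains apocentric vertices of $T_n$. Maximal uniformity. In forming $T_n$, for every $m\le n-1$ and every apocentric $\tau\prec_m\tau_0$, the number $E_\tau$ of the $\delta_n$ new edges that have an end in $\tau$ satisfies $$\Big\lfloor\frac{\delta_1\cdots\delta_m}{\delta_1\cdots\delta_{n-1}}\,\delta_n\Big\rfloor\le E_\tau\le\Big\lceil\frac{\delta_1\cdots\delta_m}{\delta_1\cdots\delta_{n-1}}\,\delta_n\Big\rceil .$$ Limit trees. For each $n$ identify $T_n$ with one of its copies $\tau_0,\ldots,\tau_{\delta_{n+1}}$ in $T_{n+1}$; this gives an inclusion chain $T_0\subset T_1\subset T_2\subset\cdots$, and $T:=\bigcup_n T_n$ is called a limit tree. It is an apocentric limit if $T_n$ is always identified with an apocentric copy ($\tau_i$ with $i\ge 1$) in $T_{n+1}$. It is a mixed limit if both central identifications (with $\tau_0$) and apocentric identifications are made infinitely often. ''$(\mathcal T,\omega)$ is almost surely an apocentric (mixed) limit'' means that almost surely the underlying tree $\mathcal T$ is isomorphic to such a limit tree. Random rooted graphs. A random rooted graph is a Borel probability measure on the set of locally finite connected rooted graphs $(G,o)$ (up to root-preserving isomorphism) with the local topology, i.e. the topology in which two rooted graphs are close if their balls of large radius around the root are isomorphic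 as rooted graphs. $B_G(v,r)$ denotes the ball of radius $r$ around $v$ in the graph distance, rooted at $v$. A random rooted graph $(G,o)$ is the Benjamini-Schramm limit of the random rooted graphs $(G_n,o_n)$, with $o_n$ uniform on the vertices of the finite graph $G_n$, if for every rooted graph $(H,\eta)$ and every integer $r\ge 0$, $\lim_{n\to\infty}P(B_{G_n}(o_n,r)\cong(H,\eta))=P(B_G(o,r)\cong(H,\eta))$. For the sequence $(T_n,o_n)$ this limit exists and is unique. An infinite tree is 1-ended if it has a ray and any two of its rays (one-way infinite paths) are eventually identical. *)

(* Defs.v *)
From HB Require Import structures.
From mathcomp Require Import all_boot all_order all_algebra.
From mathcomp Require Import all_classical all_reals all_analysis.

Set Implicit Arguments.
Unset Strict Implicit.
Unset Printing Implicit Defensive.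

Import Order.TTheory GRing.Theory Num.Theory.
Local Open Scope classical_set_scope.
Local Open Scope ring_scope.

Record graph := Graph {
  vertex :> Type;
  adj : rel vertex;
  adj_sym : symmetric adj;
  adj_irr : irreflexive adj }.

Definition graph_iso (G H : graph) : Prop :=
  exists f : G -> H, bijective f /\ forall u v, adj (f u) (f v) = adj u v.

Definition rooted_iso (G : graph) (o : G) (H : graph) (eta : H) : Prop :=
  exists f : G -> H,
    [/\ bijective f, forall u v, adj (f u) (f v) = adj u v & f o = eta].

Definition dist_le (G : graph) (r : nat) (u v : G) : Prop :=
  exists p : seq G, [/\ path (@adj G) u p, last u p = v & (size p <= r)%N].

Definition connected_graph (G : graph) : Prop :=
  forall u v : G, exists r, dist_le r u v.

Definition locally_finite_graph (G : graph) : Prop :=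
  forall v : G, finite_set [set u | adj v u].

(* [ordS] is the cyclic successor on ['I_k.+3]: the second condition forbids
   cycles of length at least 3. *)
Definition is_tree (G : graph) : Prop :=
  [/\ inhabited G, connected_graph G &
      forall k (c : 'I_k.+3 -> G),
        injective c -> ~ (forall i, adj (c i) (c (ordS i)))].

Definition is_ray (G : graph) (s : nat -> G) : Prop :=
  injective s /\ forall n, adj (s n) (s n.+1).

Definition eventually_identical (T : Type) (s t : nat -> T) : Prop :=
  exists a b, forall n, s (a + n)%N = t (b + n)%N.

Definition one_ended (G : graph) : Prop :=
  [/\ is_tree G,
      exists s : nat -> G, is_ray s &
      forall s t : nat -> G, is_ray s -> is_ray t -> eventually_identical s t].

Section ball_graph.
Variables (G : graph) (o : G) (r : nat).

Definition ball_vertex : Type := {v : G | dist_le r o v}.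
Definition ball_adj : rel ball_vertex := fun u v => adj (sval u) (sval v).

Fact ball_adj_sym : symmetric ball_adj.
Proof. by move=> u v; exact: adj_sym. Qed.

Fact ball_adj_irr : irreflexive ball_adj.
Proof. by move=> u; exact: adj_irr. Qed.

Definition ball_graph : graph := Graph ball_adj_sym ball_adj_irr.

Fact ball_root_subproof : dist_le r o o.
Proof. by exists [::]. Qed.

Definition ball_root : ball_graph := exist _ o ball_root_subproof.

End ball_graph.

Definition ball_iso (G : graph) (o : G) (r : nat) (H : graph) (eta : H) : Prop :=
  rooted_iso (ball_root o r) eta.

(* Locally finite connected graphs are countable, so vertex sets in [Set]
   realize all isomorphism types. *)
Record rooted_graph := RootedGraph {
  rg_vertex : Set;
  rg_adj : rel rg_vertex;
  rg_sym : symmetric rg_adj;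
  rg_irr : irreflexive rg_adj;
  rg_root : rg_vertex;
  rg_connected : connected_graph (Graph rg_sym rg_irr);
  rg_locally_finite : locally_finite_graph (Graph rg_sym rg_irr) }.

Definition rg_graph (G : rooted_graph) : graph := Graph (@rg_sym G) (@rg_irr G).
Coercion rg_graph : rooted_graph >-> graph.

Definition the_root (G : rooted_graph) : G := rg_root G.

Lemma rooted_iso_refl (G : graph) (o : G) : rooted_iso o o.
Proof. by exists id; split=> //; exists id. Qed.

Lemma rooted_iso_sym (G : graph) (o : G) (H : graph) (eta : H) :
  rooted_iso o eta -> rooted_iso eta o.
Proof.
move=> [f [[g fK gK] fadj fo]]; exists g; split; first by exists f.
- by move=> u v; rewrite -fadj !gK.
- by rewrite -fo fK.
Qed.

Lemma rooted_iso_trans (G : graph) (o : G) (H : graph) (eta : H)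
    (K : graph) (z : K) :
  rooted_iso o eta -> rooted_iso eta z -> rooted_iso o z.
Proof.
move=> [f [bf fadj fo]] [g [bg gadj go]]; exists (g \o f); split.
- exact: bij_comp.
- by move=> u v /=; rewrite gadj fadj.
- by rewrite /= fo.
Qed.

HB.instance Definition _ := gen_eqMixin rooted_graph.
HB.instance Definition _ := gen_choiceMixin rooted_graph.

Definition rooted_graph_iso : rel rooted_graph :=
  fun G H => `[< rooted_iso (the_root G) (the_root H) >].

Fact rooted_graph_iso_refl : reflexive rooted_graph_iso.
Proof. by move=> G; apply/asboolP; exact: rooted_iso_refl. Qed.

Fact rooted_graph_iso_sym : symmetric rooted_graph_iso.
Proof. by move=> G H; apply/asboolP/asboolP; exact: rooted_iso_sym. Qed.

Fact rooted_graph_iso_trans : transitive rooted_graph_iso.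
Proof.
by move=> H G K /asboolP GH /asboolP HK; apply/asboolP;
  exact: rooted_iso_trans GH HK.
Qed.

Canonical rooted_graph_iso_equiv :=
  EquivRel rooted_graph_iso rooted_graph_iso_refl rooted_graph_iso_sym
    rooted_graph_iso_trans.

Definition rooted_graph_class : Type := {eq_quot rooted_graph_iso}%qT.
HB.instance Definition _ := Choice.on rooted_graph_class.

(* A chosen representative; below it is only used through properties invariant
   under rooted isomorphism. *)
Definition class_rep (x : rooted_graph_class) : rooted_graph := repr x.

Section point_graph.

Definition point_adj : rel unit := fun _ _ => false.
Fact point_sym : symmetric point_adj. Proof. by []. Qed.
Fact point_irr : irreflexive point_adj. Proof. by []. Qed.
Fact point_connected : connected_graph (Graph point_sym point_irr).
Proof. by move=> [] []; exists 0%N, [::]. Qed.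
Fact point_locally_finite : locally_finite_graph (Graph point_sym point_irr).
Proof. by move=> v; exact: (sub_finite_set _ (finite_set0 _)). Qed.

Definition point_rooted_graph : rooted_graph :=
  RootedGraph tt point_connected point_locally_finite.

End point_graph.

Definition point_class : rooted_graph_class :=
  (\pi_rooted_graph_class point_rooted_graph)%qT.
HB.instance Definition _ := isPointed.Build rooted_graph_class point_class.

Definition same_ball (r : nat) (x y : rooted_graph_class) : Prop :=
  rooted_iso (ball_root (the_root (class_rep x)) r)
             (ball_root (the_root (class_rep y)) r).

Definition local_open (U : set rooted_graph_class) : Prop :=
  forall x, U x -> exists r, forall y, same_ball r x y -> U y.

Lemma sval_inj (T : Type) (Q : T -> Prop) : injective (@sval T Q).
Proof. by move=> [u pu] [v pv] /= uv; exact: eq_exist. Qed.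

Lemma dist_le_map (G H : graph) (f : G -> H) r u v :
  (forall u v, adj (f u) (f v) = adj u v) ->
  dist_le r u v -> dist_le r (f u) (f v).
Proof.
move=> fadj [p [pp lp sp]]; exists (map f p).
rewrite size_map last_map lp; split=> //.
rewrite path_map; rewrite (eq_path (e' := @adj G)) // => a b /=; exact: fadj.
Qed.

Lemma rooted_iso_ball (G : graph) (o : G) (H : graph) (eta : H) r :
  rooted_iso o eta -> rooted_iso (ball_root o r) (ball_root eta r).
Proof.
move=> [f [[g fK gK] fadj fo]].
have gadj u v : adj (g u) (g v) = adj u v by rewrite -fadj !gK.
have go : g eta = o by rewrite -fo fK.
have fP (v : ball_graph o r) : dist_le r eta (f (sval v)).
  by rewrite -fo; apply: dist_le_map => //; exact: (svalP v).
have gP (v : ball_graph eta r) : dist_le r o (g (sval v)).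
  by rewrite -go; apply: dist_le_map => //; exact: (svalP v).
exists (fun v => exist _ _ (fP v)); split.
- by exists (fun v => exist _ _ (gP v)) => v; apply: sval_inj; rewrite /= (fK, gK).
- by move=> u v; exact: fadj.
- by apply: sval_inj; rewrite /= fo.
Qed.

Lemma path_in_ball (G : graph) (o : G) s (p : seq G) k (u : ball_graph o s) :
  dist_le k o (sval u) -> (k + size p <= s)%N -> path (@adj G) (sval u) p ->
  exists2 q : seq (ball_graph o s), path (@adj _) u q & map sval q = p.
Proof.
elim: p k u => [|v p IHp] k u uk kp /=; first by exists [::].
move=> /andP[uv vp].
have vk : dist_le k.+1 o v.
  case: uk => q [pq lq sq]; exists (rcons q v).
  by rewrite rcons_path pq lq uv last_rcons size_rcons.
have vs : dist_le s o v.
  case: vk => q [pq lq sq]; exists q; split=> //.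
  by apply: leq_trans sq (leq_trans _ kp); rewrite /= addnS ltnS leq_addr.
have := IHp k.+1 (exist _ v vs) vk; rewrite addSnnS => /(_ kp vp)[q pq qp].
by exists (exist _ v vs :: q) => /=; [rewrite pq andbT|rewrite qp].
Qed.

Lemma ball_ball (G : graph) (o : G) r s : (r <= s)%N ->
  rooted_iso (ball_root (ball_root o s) r) (ball_root o r).
Proof.
move=> rs.
have fP (v : ball_graph (ball_root o s) r) : dist_le r o (sval (sval v)).
  exact: (@dist_le_map (ball_graph o s) G sval _ _ _ (fun _ _ => erefl) (svalP v)).
have gP1 (v : ball_graph o r) : dist_le s o (sval v).
  case: v => v [p [pp lp sp]]; exists p; split=> //.
  exact: leq_trans rs.
have gP2 (v : ball_graph o r) :
    dist_le r (ball_root o s) (exist _ (sval v) (gP1 v)).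
  have [p [pp lp sp]] := svalP v.
  have oo : dist_le 0 o (sval (ball_root o s)) by exists [::].
  have [|q pq qp] := path_in_ball oo _ pp; first exact: leq_trans rs.
  exists q; split=> //; last by rewrite -(size_map sval) qp.
  by apply: sval_inj; rewrite -last_map qp.
exists (fun v => exist _ _ (fP v)); split=> //.
- exists (fun v => exist _ _ (gP2 v)) => v; last exact: sval_inj.
  by do 2 apply: sval_inj.
- exact: sval_inj.
Qed.

Lemma same_ballW r s x y : (r <= s)%N -> same_ball s x y -> same_ball r x y.
Proof.
move=> rs xy.
apply: rooted_iso_trans (rooted_iso_sym (ball_ball _ rs)) _.
apply: rooted_iso_trans (rooted_iso_ball r xy) _.
exact: ball_ball.
Qed.

Fact local_openT : local_open setT.
Proof. by move=> x _; exists 0%N. Qed.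

Fact local_openI : setI_closed local_open.
Proof.
move=> U V oU oV x [/oU[r Ur] /oV[s Vs]]; exists (maxn r s) => y xy.
by split; [apply: Ur|apply: Vs]; apply: same_ballW xy;
  [exact: leq_maxl|exact: leq_maxr].
Qed.

Fact local_open_bigU (I : Type) (f : I -> set rooted_graph_class) :
  (forall i, local_open (f i)) -> local_open (\bigcup_i f i).
Proof.
by move=> fo x [i _ /fo[r fr]]; exists r => y /fr fy; exists i.
Qed.

HB.instance Definition _ := isOpenTopological.Build rooted_graph_class
  local_openT local_openI local_open_bigU.

(* The space of locally finite connected rooted graphs up to isomorphism, with
   the Borel sigma-algebra of the local topology. *)
Definition rooted_graph_space := g_sigma_algebraType (@open rooted_graph_class).

Definition random_rooted_graph (R : realType) := probability rooted_graph_space R.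

Definition underlying (x : rooted_graph_space) : graph := rg_graph (class_rep x).
Definition underlying_root (x : rooted_graph_space) : underlying x :=
  the_root (class_rep x).

Record finite_graph := FiniteGraph {
  fvertex : finType;
  fadj : rel fvertex;
  fadj_sym : symmetric fadj;
  fadj_irr : irreflexive fadj }.

Definition finite_graph_graph (G : finite_graph) : graph :=
  Graph (@fadj_sym G) (@fadj_irr G).
Coercion finite_graph_graph : finite_graph >-> graph.

Definition uniform_ball_prob (R : realType) (G : finite_graph) (r : nat)
    (H : graph) (eta : H) : R :=
  #|[set v : fvertex G | `[< ball_iso (G := G) v r eta >] ]|%:R
    / #|fvertex G|%:R.

Definition is_BS_limit (R : realType) (G : nat -> finite_graph)
    (P : random_rooted_graph R) : Prop :=
  forall (H : graph) (eta : H) (r : nat),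
    (fun n => (uniform_ball_prob R (G n) r eta)%:E) @ \oo -->
      P [set x | ball_iso (underlying_root x) r eta].

(* Only the values [delta n] with [1 <= n] are used. A vertex of T_n.+1 is
   [(None, x)] for the vertex x of the central copy of T_n, and [(Some i, x)]
   for the vertex x of the apocentric copy with index [i]. *)
Fixpoint tvertex (delta : nat -> nat) (n : nat) : finType :=
  if n is m.+1 then (option 'I_(delta n) * tvertex delta m)%type : finType
  else unit : finType.

(* [a n i] is the apocentric vertex of the central copy of T_n in T_n.+1 joined
   to the center of the apocentric copy with index [i]. *)
Definition attachment (delta : nat -> nat) :=
  forall n, 'I_(delta n.+1) -> tvertex delta n.

Section trees.
Variables (delta : nat -> nat) (a : attachment delta).

Fixpoint center n : tvertex delta n :=
  if n is m.+1 then (None, center m) else tt.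

Fixpoint apocentric n : pred (tvertex delta n) :=
  if n is m.+1 then fun x => isSome x.1 && apocentric x.2 else xpredT.

Definition new_edge n (x y : tvertex delta n.+1) : bool :=
  if (x.1, y.1) is (None, Some i) then (x.2 == a i) && (y.2 == center n)
  else false.

Fixpoint tadj n : rel (tvertex delta n) :=
  if n is m.+1 then
    fun x y => [|| (x.1 == y.1) && tadj x.2 y.2, @new_edge m x y
                 | @new_edge m y x]
  else fun _ _ => false.

Fact tadj_sym n : symmetric (@tadj n).
Proof.
elim: n => [//|n IHn] x y /=; rewrite eq_sym IHn; congr (_ || _).
exact: orbC.
Qed.

Fact tadj_irr n : irreflexive (@tadj n).
Proof. by elim: n => [//|n IHn] [[i|] x]; rewrite /= IHn ?andbF. Qed.

Definition tree (n : nat) : finite_graph :=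
  FiniteGraph (@tadj_sym n) (@tadj_irr n).

(* [canonical_copy m n A]: A is the vertex set of a canonical copy of T_m in
   T_n. *)
Inductive canonical_copy (m : nat) : forall n, {set tvertex delta n} -> Prop :=
| canonical_copy_refl : canonical_copy m (n := m) [set: tvertex delta m]%SET
| canonical_copy_step n (i : option 'I_(delta n.+1)) (A : {set tvertex delta n}) :
    canonical_copy m A ->
    canonical_copy m (n := n.+1) [set (i, x) | x in A]%SET.

Definition apocentric_copy m n (A : {set tvertex delta n}) : Prop :=
  canonical_copy m A /\ exists2 x, x \in A & apocentric x.

Definition new_edges_at n (A : {set tvertex delta n}) : nat :=
  #|[set i : 'I_(delta n.+1) | a i \in A]%SET|.

Definition uniform_share (m n : nat) : rat :=
  (\prod_(1 <= k < m.+1) (delta k)%:R) / (\prod_(1 <= k < n.+1) (delta k)%:R)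
  * (delta n.+1)%:R.

Definition maximally_uniform : Prop :=
  forall n m (A : {set tvertex delta n}), (m <= n)%N -> apocentric_copy m A ->
    Num.floor (uniform_share m n) <= (new_edges_at A)%:Z
      <= Num.ceil (uniform_share m n).

Definition associated_trees : Prop :=
  (forall n (i : 'I_(delta n.+1)), apocentric (a i)) /\ maximally_uniform.

(* [c n] is the copy of T_n in T_n.+1 with which T_n is identified; the maps
   [f n] exhibit G as the increasing union of the T_n. *)
Definition limit_along (c : forall n, option 'I_(delta n.+1)) (G : graph)
  : Prop :=
  exists f : forall n, tree n -> G,
    [/\ forall n, injective (f n),
        forall n (x : tree n), f n.+1 (c n, x) = f n x,
        forall v, exists n x, f n x = v &
        forall u v, adj u v <->
          exists n (x y : tree n), [/\ f n x = u, f n y = v & adj x y]].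

Definition apocentric_limit (G : graph) : Prop :=
  exists c, (forall n, c n != None) /\ limit_along c G.

Definition mixed_limit (G : graph) : Prop :=
  exists c,
    [/\ forall N, exists2 n, (N <= n)%N & c n = None,
        forall N, exists2 n, (N <= n)%N & c n != None &
        limit_along c G].

End trees.

(* Main.v *)
(* A vertex of an inductive limit of the T_n is an infinite address, and the
   limit along c is the class of addresses agreeing with c from some index on.
   In binary, the depth below the center of a vertex of T_n has the bits
   "x k <> None" (k < n), and the parent of a vertex is obtained by binary
   decrement. At most 2^n * delta_n.+1 vertices of T_n, out of at least 3^n,
   lie above the delta_n.+1 vertices attached to T_n when T_n becomes central,
   which happens with probability 1 / (delta_n.+1 + 1); since the sum of
   (2/3)^n converges, Borel-Cantelli shows that for almost every address c all
   descendants are eventually confined to some T_n. Hence balls stabilize,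
   rays must eventually ascend (one-endedness), and the law of the limit is
   the image of the uniform measure on addresses. That measure is never built:
   null sets of addresses are covered by cylinders, and compactness of the
   space of addresses transfers the finite counts to P.
   In the slow-growing case almost every limit contains, for each m, a copy of
   T_m below which nothing is attached. Such dead ends make the depth modulo
   2^m an isomorphism invariant of the rooted tree, so the whole central/
   apocentric pattern of c is determined by the tree; each pattern has
   probability at most prod delta_n / (delta_n + 1) = 0. *)

Require Import Defs.
From mathcomp Require Import all_boot all_order all_algebra.
From mathcomp Require Import all_classical all_reals all_analysis.
From mathcomp Require Import zify lra.
Set Implicit Arguments.
Unset Strict Implicit.
Unset Printing Implicit Defensive.
Import Order.TTheory GRing.Theory Num.Theory.
Local Open Scope classical_set_scope.
Local Open Scope ring_scope.

(** * Addresses *)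

Section sequences.
Variable delta : nat -> nat.

(* [x n] is the copy of T_n in T_n.+1 containing the vertex. *)
Definition address := forall n, option 'I_(delta n.+1).

Fixpoint pre (x : address) n : tvertex delta n :=
  if n is m.+1 then (x m, pre x m) else tt.

Fixpoint ins n : tvertex delta n -> address -> address :=
  
  if n is m.+1 then fun (v : tvertex delta m.+1) c => @dfwith _ _ (ins v.2 c) m v.1
  else fun _ c => c.

(** Both vertices lie in the same canonical copy of T_n. *)
Definition agree n (x y : address) := forall k, (n <= k)%N -> x k = y k.

Lemma agree_refl n x : agree n x x. Proof. by []. Qed.

Lemma agree_sym n x y : agree n x y -> agree n y x.
Proof. by move=> xy k nk; rewrite xy. Qed.

Lemma agree_trans n x y z : agree n x y -> agree n y z -> agree n x z.
Proof. by move=> xy yz k nk; rewrite xy ?yz. Qed.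

Lemma agreeW m n x y : (m <= n)%N -> agree m x y -> agree n x y.
Proof. by move=> mn xy k nk; apply: xy; exact: leq_trans nk. Qed.

Lemma eq_pre n x y : pre x n = pre y n <-> forall k, (k < n)%N -> x k = y k.
Proof.
elim: n => [|n IHn] /=; first by [].
split=> [[xn /IHn xyn] k|xyn]; last first.
  by rewrite xyn // (IHn.2) // => k kn; apply: xyn; exact: ltnW.
by rewrite ltnS leq_eqVlt => /orP[/eqP->|/xyn].
Qed.

Lemma address_eq n x y : pre x n = pre y n -> agree n x y -> x = y.
Proof.
move=> /eq_pre xy xy'; apply: functional_extensionality_dep => k.
by case: (ltnP k n) => [/xy|/xy'].
Qed.

Lemma ins_agree n (v : tvertex delta n) c : agree n (ins v c) c.
Proof.
elim: n v => [//|n IHn] [i v] k nk /=.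
by rewrite dfwithout ?IHn //; [exact: ltnW|lia].
Qed.

Lemma preK n (v : tvertex delta n) c : pre (ins v c) n = v.
Proof.
elim: n v => [[]//|n IHn] [i v] /=; congr (_, _); first by rewrite dfwithin.
rewrite -[RHS]IHn; apply/eq_pre => k kn; rewrite dfwithout //.
by lia.
Qed.

Lemma ins_pre n (x c : address) : agree n x c -> ins (pre x n) c = x.
Proof.
move=> xc; apply: (@address_eq n); first by rewrite preK.
by apply: agree_trans (ins_agree _ _) _; exact: agree_sym.
Qed.

End sequences.

(** * Parents and depth *)

Section parents.
Variables (delta : nat -> nat) (a : attachment delta).
Local Notation address := (address delta).

Lemma pre_center n (x : address) :
  pre x n = Defs.center delta n <-> forall k, (k < n)%N -> x k = None.
Proof.
elim: n => [|n IHn] /=; first by [].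
split=> [[xn /IHn xN] k|xN]; last first.
  by rewrite xN // (IHn.2) // => k kn; apply: xN; exact: ltnW.
by rewrite ltnS leq_eqVlt => /orP[/eqP->|/xN].
Qed.

Lemma apocentric_pre n (x : address) :
  apocentric (pre x n) <-> forall k, (k < n)%N -> isSome (x k).
Proof.
elim: n => [|n IHn] /=; first by [].
split=> [/andP[xn /IHn xS] k|xS]; last first.
  by rewrite xS // (IHn.2) // => k kn; apply: xS; exact: ltnW.
by rewrite ltnS leq_eqVlt => /orP[/eqP->|/xS].
Qed.

Fixpoint dep n (x : address) : nat :=
  if n is m.+1 then (dep m x + isSome (x m) * 2 ^ m)%N else 0%N.

Lemma eq_dep n (x y : address) :
  (forall k, (k < n)%N -> x k = y k) -> dep n x = dep n y.
Proof.
elim: n => [//|n IHn] xy /=; rewrite xy // IHn // => k kn.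
by apply: xy; exact: ltnW.
Qed.

Lemma dep_lt n x : (dep n x < 2 ^ n)%N.
Proof. by elim: n => [//|n IHn] /=; rewrite expnS; case: (isSome _); lia. Qed.

Lemma dep_eq0 n x : dep n x = 0%N <-> forall k, (k < n)%N -> x k = None.
Proof.
elim: n => [|n IHn] /=; first by [].
have p0 : (0 < 2 ^ n)%N by rewrite expn_gt0.
split=> [e k|xN]; last first.
  by rewrite xN // (IHn.2) // => k kn; apply: xN; exact: ltnW.
rewrite ltnS leq_eqVlt => /orP[/eqP->|]; last by apply: IHn.1; lia.
by move: e; case: (x n) => //= i; lia.
Qed.

Lemma dep_full n x : (forall k, (k < n)%N -> isSome (x k)) -> (dep n x).+1 = (2 ^ n)%N.
Proof.
elim: n => [//|n IHn] xS /=.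
have := IHn (fun k kn => xS k (ltnW kn)); rewrite xS // expnS; lia.
Qed.

(* [y] is the parent of [x]; the joining edge is created when T_k.+1 is formed. *)
Definition par_at k (x y : address) := exists i,
  [/\ x k = Some i, y k = None, pre x k = Defs.center delta k, pre y k = a i
    & agree k.+1 x y].

Definition par x y := exists k, par_at k x y.

(** The least index with a [Some] acts as the lowest set bit: below it the address is a center, and
    replacing this prefix by the attachment vertex gives the parent. As k <= n, the parent is in the
    same copy of T_n.+1. *)
Lemma par_exists x n : isSome (x n) -> exists k y, (k <= n)%N /\ par_at k x y.
Proof.
move=> xn; have /ex_minnP[k xk kmin] : exists k, isSome (x k) by exists n.
case E: (x k) xk => [i|//] _.
exists k, (dfwith (ins (a i) x) k None); split; first exact: kmin.
exists i; split=> //.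
- exact: dfwithin.
- apply/pre_center => j jk; case F: (x j) => [//|//].
  by have := kmin j; rewrite F leqNgt jk => /(_ isT).
- rewrite -[RHS](preK (a i) x); apply/eq_pre => j jk.
  by rewrite dfwithout //; lia.
- move=> j kj; rewrite dfwithout; last by lia.
  by rewrite ins_agree //; exact: ltnW.
Qed.

(** The stage k is forced to be the least index carrying a [Some], and the clauses of [par_at] then
    fix every coordinate of the parent. *)
Lemma par_at_fun k l x y z : par_at k x y -> par_at l x z -> k = l /\ y = z.
Proof.
move=> [i [xi yN /pre_center x0 ya xy]] [j [xj zN /pre_center x0' za xz]].
have kl : k = l.
  case: (ltngtP k l) => // [/x0'|/x0]; first by rewrite xi.
  by rewrite xj.
subst l; split=> //.
have ij : i = j by move: xj; rewrite xi => -[].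
apply: (@address_eq _ k); first by rewrite ya za ij.
move=> m; rewrite leq_eqVlt => /orP[/eqP<-|km]; first by rewrite yN zN.
by rewrite -xy // xz.
Qed.

Lemma par_fun x y z : par x y -> par x z -> y = z.
Proof. by move=> [k xy] [l xz]; have [] := par_at_fun xy xz. Qed.

Lemma par_at_agree k n x y : par_at k x y -> agree n x y <-> (k < n)%N.
Proof.
move=> [i [xi yN _ _ xy]]; split=> [xyn|kn]; last exact: agreeW xy.
by rewrite ltnNge; apply/negP => /xyn; rewrite xi yN.
Qed.

Hypothesis a_apo : forall n (i : 'I_(delta n.+1)), apocentric (a i).

Lemma par_at_some k x y : par_at k x y -> forall j, (j < k)%N -> isSome (y j).
Proof. by move=> [i [_ _ _ ya _]]; apply/apocentric_pre; rewrite ya. Qed.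

(** For n <= k the decrement borrows past the first n bits: all zeros become all ones, because
    attachment vertices are apocentric. *)
Lemma par_at_dep k n x y : par_at k x y ->
  if (k < n)%N then dep n x = (dep n y).+1
  else dep n x = 0%N /\ (dep n y).+1 = (2 ^ n)%N.
Proof.
move=> xy; have yS := par_at_some xy; case: xy => i [xi yN /pre_center x0 _ xy].
case: ltnP => kn; last first.
  by split; [apply/dep_eq0|apply: dep_full] => j jn; [apply: x0|apply: yS];
    exact: leq_trans kn.
elim: n kn => [//|n IHn]; rewrite ltnS leq_eqVlt => /orP[/eqP kn|kn] /=.
  subst n; rewrite xi yN (dep_eq0 k x).2 //= addn0 add0n mul1n.
  by rewrite dep_full.
by rewrite IHn // xy.
Qed.

Lemma par_dep n x y : par x y -> agree n x y -> dep n x = (dep n y).+1.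
Proof.
by move=> [k xy] /(par_at_agree n xy) kn; have := par_at_dep n xy; rewrite kn.
Qed.

Lemma par_dep_mod n x y : par x y -> dep n x = (dep n y).+1 %[mod 2 ^ n].
Proof.
move=> [k /(par_at_dep n)]; case: ifP => [_ -> //|_ [-> ->]].
by rewrite modnn mod0n.
Qed.

(* [x] is the [h]-th ancestor of [z]. *)
Fixpoint anc h (z x : address) : Prop :=
  if h is h'.+1 then exists2 y, par z y & anc h' y x else z = x.

Lemma anc_rcons h z y x : anc h z y -> par y x -> anc h.+1 z x.
Proof.
elim: h z => [|h IHh] z /=; first by move=> ->; exists x.
by move=> [w zw wy] yx; exists w => //; exact: IHh wy yx.
Qed.

Lemma anc_fun h z x y : anc h z x -> anc h z y -> x = y.
Proof.
elim: h z => [|h IHh] z /=; first by move=> -> ->.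
by move=> [w zw wx] [w' zw']; rewrite (par_fun zw' zw); exact: IHh.
Qed.

Definition tail_eq (x y : address) := exists n, agree n x y.

Lemma par_tail x y : par x y -> tail_eq x y.
Proof. by move=> [k [i [_ _ _ _ xy]]]; exists k.+1. Qed.

Lemma tail_eq_refl x : tail_eq x x. Proof. by exists 0%N. Qed.

Lemma tail_eq_sym x y : tail_eq x y -> tail_eq y x.
Proof. by move=> [n xy]; exists n; exact: agree_sym. Qed.

Lemma tail_eq_trans x y z : tail_eq x y -> tail_eq y z -> tail_eq x z.
Proof.
move=> [n xy] [m yz]; exists (maxn n m); apply: (@agree_trans _ _ _ y).
  by apply: agreeW xy; exact: leq_maxl.
by apply: agreeW yz; exact: leq_maxr.
Qed.

(** An ancestor chain is finite, so it lies in one copy of T_N, where each step up lowers the depth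
    by exactly one. *)
Lemma anc_dep_large h z x : anc h z x ->
  exists N, forall n, (N <= n)%N -> dep n z = (dep n x + h)%N.
Proof.
elim: h z => [|h IHh] z /=; first by move=> ->; exists 0%N => n _; rewrite addn0.
move=> [y zy /IHh[N HN]]; have [M zyM] := par_tail zy.
exists (maxn N M) => n; rewrite geq_max => /andP[Nn Mn].
by rewrite (par_dep zy) ?HN ?addnS //; exact: agreeW zyM.
Qed.

(* [dep m x - dep n x] only depends on the coordinates from [n] on; stated
   without subtraction. *)
Lemma agree_dep n m x y : agree n x y -> (n <= m)%N ->
  (dep m x + dep n y = dep m y + dep n x)%N.
Proof.
move=> xy; elim: m => [|m IHm]; first by rewrite leqn0 => /eqP->.
rewrite leq_eqVlt => /orP[/eqP->|]; first by rewrite addnC.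
by rewrite ltnS => nm /=; have := IHm nm; rewrite xy //; lia.
Qed.

(** The chain is not assumed to stay in the copy of T_n: depths are compared in a larger copy and
    brought back to n by [agree_dep]. *)
Lemma anc_dep n h z x : anc h z x -> agree n z x -> dep n z = (dep n x + h)%N.
Proof.
move=> /anc_dep_large[N HN] zx.
have := HN (maxn N n) (leq_maxl _ _).
have := agree_dep zx (leq_maxr N n); lia.
Qed.

Lemma anc_irr h x : anc h.+1 x x -> False.
Proof. by move=> /(@anc_dep 0) /(_ (agree_refl _)); lia. Qed.

Definition root_of n x : address := ins (Defs.center delta n) x.

Lemma root_of_agree n x : agree n (root_of n x) x.
Proof. exact: ins_agree. Qed.

Lemma root_of_eq n x y : agree n x y -> root_of n x = root_of n y.
Proof.
move=> xy; apply: (@address_eq _ n); first by rewrite !preK.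
apply: (agree_trans (root_of_agree x)); apply: (agree_trans xy).
exact: agree_sym (root_of_agree y).
Qed.

(** Nonzero depth means a [Some] below n, so the parent stays in the same copy of T_n, with the same
    center. *)
Lemma anc_root n x : anc (dep n x) x (root_of n x).
Proof.
move E: (dep n x) => h; elim: h x E => [|h IHh] x xh.
  apply: (@address_eq _ n); last exact: agree_sym (root_of_agree x).
  by rewrite preK; apply/pre_center/dep_eq0.
have [k kn xk] : exists2 k, (k < n)%N & isSome (x k).
  apply: contrapT => H; have : dep n x = 0%N.
    apply/dep_eq0 => k kn; case E: (x k) => [i|//]; exfalso; apply: H.
    by exists k; rewrite ?E.
  by rewrite xh.
have [l [y [lk xy]]] := par_exists xk.
have ln : (l < n)%N by exact: leq_ltn_trans kn.
have axy : agree n x y by apply/(par_at_agree n xy).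
exists y; first by exists l.
have yh : dep n y = h by have := par_dep (ex_intro _ l xy) axy; lia.
by rewrite (root_of_eq axy); exact: IHh.
Qed.

End parents.

(** * The graph of addresses *)

Section graph_distance.
Variable G : graph.

Lemma dist_le0 (u : G) : dist_le 0 u u. Proof. by exists [::]. Qed.

Lemma dist_le0_eq (u v : G) : dist_le 0 u v -> u = v.
Proof. by move=> [[|? ?] [_ <-]]. Qed.

Lemma dist_leW r s (u v : G) : (r <= s)%N -> dist_le r u v -> dist_le s u v.
Proof. by move=> rs [p [pp lp sp]]; exists p; split=> //; exact: leq_trans rs. Qed.

Lemma dist_leSr r (u v w : G) : dist_le r u v -> adj v w -> dist_le r.+1 u w.
Proof.
move=> [p [pp <- sp]] vw; exists (rcons p w).
by rewrite rcons_path pp vw last_rcons size_rcons.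
Qed.

Lemma dist_leSr_inv r (u w : G) : dist_le r.+1 u w ->
  dist_le r u w \/ exists2 v, dist_le r u v & adj v w.
Proof.
move=> [p [pp lp]]; elim/last_ind: p pp lp => [|p v _] pp lp sp.
  by left; exists [::].
move: pp lp sp; rewrite rcons_path last_rcons size_rcons => /andP[pp pv] <- sp.
by right; exists (last u p) => //; exists p.
Qed.

Lemma dist_le_trans r s (u v w : G) :
  dist_le r u v -> dist_le s v w -> dist_le (r + s) u w.
Proof.
move=> [p [pp lp sp]] [q [pq lq sq]]; exists (p ++ q).
by rewrite cat_path last_cat pp lp pq lq size_cat leq_add.
Qed.

Lemma dist_le_sym r (u v : G) : dist_le r u v -> dist_le r v u.
Proof.
elim: r v => [|r IHr] v; first by move=> /dist_le0_eq->; exact: dist_le0.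
move=> /dist_leSr_inv[/IHr|[w /IHr wu wv]]; first exact: dist_leW.
rewrite -add1n; apply: dist_le_trans wu; apply: dist_leSr (dist_le0 v) _.
by rewrite adj_sym.
Qed.

End graph_distance.

Section address_graph.
Variables (delta : nat -> nat) (a : attachment delta).
Hypothesis a_apo : forall n (i : 'I_(delta n.+1)), apocentric (a i).
Local Notation address := (address delta).
Local Notation par := (par a).
Local Notation par_at := (par_at a).
Local Notation anc := (anc a).

Definition address_adj : rel address := fun x y => `[< par x y \/ par y x >].

Fact address_adj_sym : symmetric address_adj.
Proof. by move=> x y; apply: asbool_equiv_eq; tauto. Qed.

Lemma par_irr x : ~ par x x.
Proof. by move=> [k [i [xi]]]; rewrite xi. Qed.

Fact address_adj_irr : irreflexive address_adj.
Proof. by move=> x; apply/asboolP => -[] /par_irr. Qed.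

Definition address_graph : graph := Graph address_adj_sym address_adj_irr.

Lemma new_edge_pre n x y : agree n.+1 x y ->
  new_edge a (pre y n.+1) (pre x n.+1) <-> par_at n x y.
Proof.
move=> xy; rewrite /new_edge /=; split.
  case yN: (y n) => [//|]; case xi: (x n) => [i|//].
  by move=> /andP[/eqP ya /eqP x0]; exists i.
by move=> [i [-> -> -> -> _]]; rewrite !eqxx.
Qed.

(** In the step to n.+1, equal last coordinates leave only edges inherited from T_n, and different
    ones only edges created at stage n. *)
Lemma tadj_pre n x y : agree n x y ->
  tadj a (pre x n) (pre y n) <-> par x y \/ par y x.
Proof.
elim: n => [|n IHn] xy.
  by have -> : x = y; [exact: (@address_eq _ 0)|split=> // -[] /par_irr].
rewrite [tadj _ _ _]/=; have yx := agree_sym xy.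
have [xyn|xyn] := pselect (x n = y n).
  have {}xy : agree n x y.
    by move=> k; rewrite leq_eqVlt => /orP[/eqP<-|/xy].
  rewrite -IHn // xyn eqxx /= /new_edge /=.
  by case: (y n); rewrite !orbF.
have key z w : agree n.+1 z w -> z n <> w n -> par z w <-> par_at n z w.
  move=> zw zwn; split=> [[k kzw]|]; last by exists n.
  have /(par_at_agree n.+1 kzw) := zw.
  rewrite ltnS leq_eqVlt => /orP[/eqP <- //|].
  by move=> /(par_at_agree n kzw) /(_ n (leqnn _)).
rewrite (key _ _ xy xyn) (key _ _ yx (nesym xyn)).
rewrite -(new_edge_pre xy) -(new_edge_pre yx).
have -> : (x n == y n) = false by apply/eqP.
by rewrite /= orbC; exact: iff_sym (rwP orP).
Qed.

Lemma adj_addressE x y : @adj address_graph x y <-> par x y \/ par y x.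
Proof. by split=> /asboolP. Qed.

Lemma adj_ins n (v w : tree a n) c :
  @adj address_graph (ins v c) (ins w c) = adj v w.
Proof.
have vw : agree n (ins v c) (ins w c).
  by apply: agree_trans (ins_agree _ _) _; apply: agree_sym; exact: ins_agree.
have := tadj_pre vw; rewrite !preK -adj_addressE => H.
by apply/idP/idP => /H.
Qed.

Lemma adj_tail x y : @adj address_graph x y -> tail_eq x y.
Proof.
by move=> /adj_addressE[/par_tail//|/par_tail/tail_eq_sym].
Qed.

Lemma dist_tail r (x y : address_graph) : dist_le r x y -> tail_eq x y.
Proof.
elim: r y => [|r IHr] y; first by move=> /dist_le0_eq->; exact: tail_eq_refl.
move=> /dist_leSr_inv[/IHr//|[z /IHr xz /adj_tail]]; exact: tail_eq_trans.
Qed.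

Lemma anc_dist h z x : anc h z x -> dist_le (G := address_graph) h z x.
Proof.
elim: h z => [|h IHh] z; first by move=> ->; exact: dist_le0.
move=> [y zy /IHh]; rewrite -add1n; apply: dist_le_trans.
by apply: dist_leSr (dist_le0 _) _; apply/adj_addressE; left.
Qed.

Lemma tail_dist x y : tail_eq x y -> exists r, dist_le (G := address_graph) r x y.
Proof.
move=> [n xy]; exists (dep n x + dep n y)%N.
apply: dist_le_trans; first exact/anc_dist/anc_root.
by apply: dist_le_sym; rewrite (root_of_eq xy); exact/anc_dist/anc_root.
Qed.

Definition bounded_descent x := exists H, forall h z, anc h z x -> (h <= H)%N.

(** A ray that descends once descends forever: turning up would revisit the unique parent just left,
    against injectivity. Bounded descent forbids this. *)
Lemma ray_up (s : nat -> address_graph) : is_ray s ->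
  (forall n, bounded_descent (s n)) -> forall n, par (s n) (s n.+1).
Proof.
move=> [s_inj s_adj] s_fin n.
have /adj_addressE[//|down] := s_adj n; exfalso.
have dn h : par (s (n + h).+1) (s (n + h)%N).
  elim: h => [|h IHh]; first by rewrite addn0.
  have /adj_addressE[up|] := s_adj (n + h).+1; last by rewrite addnS.
  by have /s_inj := par_fun IHh up; lia.
have anch h : anc h (s (n + h)%N) (s n).
  elim: h => [|h IHh]; first by rewrite addn0.
  by rewrite addnS; exists (s (n + h)%N) => //; exact: dn.
by have [H /(_ _ _ (anch H.+1))] := s_fin n; rewrite ltnn.
Qed.

(** This gives every vertex of the limit along [c] a parent. *)
Definition rising (c : address) := forall n, exists2 k, (n <= k)%N & isSome (c k).

Lemma rising_par c x : rising c -> tail_eq x c -> exists y, par x y.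
Proof.
move=> cS [n xc]; have [k nk ck] := cS n.
have [|l [y [_ xy]]] := @par_exists _ a x k; first by rewrite xc.
by exists y, l.
Qed.

Lemma ancestral_ray c x : rising c -> tail_eq x c ->
  exists s : nat -> address_graph,
    [/\ s 0%N = x, is_ray s & forall n, par (s n) (s n.+1)].
Proof.
move=> cS xc.
have /choice[p pP] : forall y, exists z, tail_eq y c -> par y z.
  move=> y; have [yc|] := pselect (tail_eq y c); last by exists y.
  by have [z yz] := rising_par cS yc; exists z.
have sc n : tail_eq (iter n p x) c.
  elim: n => [//|n IHn] /=; have /par_tail/tail_eq_sym yx := pP _ IHn.
  exact: tail_eq_trans yx IHn.
have sp n : par (iter n p x) (iter n.+1 p x) by exact: pP.
exists (fun n => iter n p x); split=> //; split; last first.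
  by move=> n; apply/adj_addressE; left.
have sa n h : anc h (iter n p x) (iter (n + h) p x).
  elim: h => [|h IHh]; first by rewrite addn0.
  by rewrite addnS; exact: anc_rcons IHh (sp _).
move=> m n mn; case: (ltngtP m n) => // lt.
- have := sa m (n - m.+1).+1; rewrite (_ : m + _ = n)%N; last by lia.
  by rewrite mn => /anc_irr; case.
- have := sa n (m - n.+1).+1; rewrite (_ : n + _ = m)%N; last by lia.
  by rewrite mn => /anc_irr; case.
Qed.

Lemma up_anc (s : nat -> address) : (forall n, par (s n) (s n.+1)) ->
  forall h n, anc h (s n) (s (n + h)%N).
Proof.
move=> sp; elim=> [|h IHh] n; first by rewrite addn0.
by exists (s n.+1) => //; rewrite addnS -addSn.
Qed.

(** Both sequences reach the center of a common copy of T_n, after as many steps as their initial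
    depths, and parents are unique from there on. *)
Lemma up_meet (s t : nat -> address) : (forall n, par (s n) (s n.+1)) ->
  (forall n, par (t n) (t n.+1)) -> tail_eq (s 0%N) (t 0%N) ->
  eventually_identical s t.
Proof.
move=> sp tp [n st]; exists (dep n (s 0%N)), (dep n (t 0%N)).
elim=> [|k IHk]; last first.
  by rewrite !addnS; apply: par_fun (sp _) _; rewrite IHk.
rewrite !addn0; have := up_anc sp (dep n (s 0%N)) 0; rewrite add0n.
move=> /(anc_fun (anc_root a_apo _ _)) <-.
have := up_anc tp (dep n (t 0%N)) 0; rewrite add0n.
move=> /(anc_fun (anc_root a_apo _ _)) <-.
exact: root_of_eq.
Qed.

(** A deepest vertex of a cycle has both its neighbours as parent, so they coincide, which is
    impossible in a cycle of length at least 3. *)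
Lemma address_acyclic k (c : 'I_k.+3 -> address_graph) : injective c ->
  ~ (forall i, adj (c i) (c (ordS i))).
Proof.
move=> c_inj cP.
have cT i : tail_eq (c i) (c ord0).
  case: i => i; elim: i => [|i IHi] ik.
    by rewrite (_ : Ordinal ik = ord0); [exact: tail_eq_refl|exact: val_inj].
  apply: tail_eq_trans (IHi (ltnW ik)); apply: tail_eq_sym.
  apply: adj_tail; have := cP (Ordinal (ltnW ik)).
  by rewrite (_ : ordS _ = Ordinal ik) //; apply: val_inj; rewrite /= modn_small.
have /choice[N NP] := cT.
(* One copy of T_M contains the whole cycle, so depths in it can be compared. *)
pose M := \max_i N i.
have ag i j : agree M (c i) (c j).
  have H l : agree M (c l) (c ord0) by apply: agreeW (NP l); exact: leq_bigmax.
  by apply: agree_trans (H i) _; exact: agree_sym.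
have [i0 _ imax] := arg_maxnP (fun i => dep M (c i)) (erefl (xpredT (ord0 : 'I_k.+3))).
have up j : @adj address_graph (c i0) (c j) -> par (c i0) (c j).
  move=> /adj_addressE[//|ji]; have := par_dep a_apo ji (ag _ _).
  by have := imax j isT; lia.
have pr : ordS (ord_pred i0) = i0 by rewrite ord_predK.
have e : c (ordS i0) = c (ord_pred i0).
  apply: par_fun (up _ (cP _)) (up _ _).
  by rewrite adj_sym; have := cP (ord_pred i0); rewrite pr.
move/c_inj: e => /(congr1 val) /=.
case: i0 {imax up pr} => i ik /=; case: i ik => [|i] ik.
  by rewrite add0n /= !modn_small.
rewrite (_ : (i.+1 + k.+3).-1 = i + k.+3)%N; last by lia.
rewrite modnDr (@modn_small i) //; last by lia.
have [e|lt] : i.+1 = k.+2 \/ (i.+2 < k.+3)%N by lia.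
  by rewrite e modnn; lia.
by rewrite modn_small //; lia.
Qed.

End address_graph.

(** * Confined addresses and one-endedness *)

Section confinement.
Variables (delta : nat -> nat) (a : attachment delta).
Hypothesis a_apo : forall n (i : 'I_(delta n.+1)), apocentric (a i).
Local Notation address := (address delta).
Local Notation par := (par a).
Local Notation par_at := (par_at a).
Local Notation anc := (anc a).
Local Notation address_graph := (address_graph a).

(* The parent inside T_n; the center is fixed. *)
Fixpoint tpar n : tvertex delta n -> tvertex delta n :=
  if n is m.+1 then fun v : tvertex delta m.+1 =>
    if v.2 == Defs.center delta m then
      if v.1 is Some i then (None, a i) else v
    else (v.1, tpar v.2)
  else id.

Lemma tpar_pre n x y : par x y -> agree n x y -> tpar (pre x n) = pre y n.
Proof.
move=> [k xy] /(par_at_agree n xy); elim: n => [//|n IHn].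
case: xy IHn => i [xi yN /pre_center x0 ya xy] IHn.
rewrite ltnS leq_eqVlt => /orP[/eqP kn|kn].
  by subst n; rewrite /= (pre_center k x).2 // eqxx xi ya yN.
rewrite /= IHn // xy //; case: eqP => // /pre_center /(_ k kn).
by rewrite xi.
Qed.

(** The vertices of T_j that gain descendants when T_j becomes central: the attachment vertices and
    their ancestors. Depths in T_j are below 2^j, so the iterations counted reach every ancestor. *)
Definition feeders j : {set tvertex delta j} :=
  [set iter p.2 (@tpar j) (a p.1) | p : 'I_(delta j.+1) * 'I_(2 ^ j)]%SET.

Lemma card_feeders j : (#|feeders j| <= delta j.+1 * 2 ^ j)%N.
Proof. by rewrite (leq_trans (leq_imset_card _ _)) // card_prod !card_ord. Qed.

(* The copy of T_m at [c] never gains a descendant outside the copy of T_M, and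
   its center acquires its parent inside the copy of T_M. *)
Definition confined m M (c : address) :=
  (forall j, (M <= j)%N -> c j = None ->
     forall x, agree m x c -> pre x j \notin feeders j) /\
  (exists k, (m <= k < M)%N /\ isSome (c k)).

Lemma confined_leq m M c : confined m M c -> (m <= M)%N.
Proof. by move=> [_ [k [mk _]]]; lia. Qed.

Lemma confined_anc m M c x h z : confined m M c -> agree m x c -> anc h z x ->
  agree M z x /\ forall j, (M <= j)%N -> pre x j = iter h (@tpar j) (pre z j).
Proof.
move=> mMc xc; have mM := confined_leq mMc; case: mMc => feed _.
elim: h z => [|h IHh] z; first by move=> /= ->; split.
move=> [y [k zy] yx]; have [yxM yxj] := IHh _ yx.
have [kM|Mk] := ltnP k M.
  have zyM : agree M z y by apply/(par_at_agree M zy).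
  split=> [|j Mj]; first exact: agree_trans yxM.
  rewrite yxj // iterSr (tpar_pre (y := y)) //; first by exists k.
  exact: agreeW zyM.
have [i [_ yN _ ya _]] := zy.
have ck : c k = None by rewrite -xc ?(leq_trans mM) // -yxM.
have /negP[] := feed k Mk ck x xc.
have yxk : agree k y x by exact: agreeW yxM.
have hk : (h < 2 ^ k)%N.
  by have := anc_dep a_apo yx yxk; have := dep_lt k y; lia.
by apply/imsetP; exists (i, Ordinal hk) => //=; rewrite -ya -yxj.
Qed.

Lemma confined_descent m M c x : confined m M c -> agree m x c ->
  bounded_descent a x.
Proof.
move=> mMc xc; exists (2 ^ M)%N => h z zx.
have [zxM _] := confined_anc mMc xc zx.
by have := anc_dep a_apo zx zxM; have := dep_lt M z; lia.
Qed.

(** Children are controlled by [confined_anc]; the parent edge is created at a stage below M because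
    [c] has a [Some] between m and M. *)
Lemma confined_adj m M c (x y : address_graph) : confined m M c ->
  agree m x c -> adj x y -> agree M y c.
Proof.
move=> mMc xc /adj_addressE[]; last first.
  move=> yx; have yx1 : anc 1 y x by exists x.
  have [yxM _] := confined_anc mMc xc yx1.
  by apply: agree_trans yxM _; apply: agreeW xc; exact: confined_leq mMc.
case: (mMc) => _ [k [/andP[mk kM] ck]] xy.
have [|l [z [lk xz]]] := @par_exists _ a x k; first by rewrite xc.
have -> : y = z by apply: par_fun xy _; exists l.
apply: agree_trans (agreeW (confined_leq mMc) xc).
by apply: agree_sym; apply/(par_at_agree M xz); exact: leq_ltn_trans kM.
Qed.

Definition tame c := forall m, exists M, confined m M c.

Lemma tame_rising c : tame c -> rising c.
Proof.
by move=> ct n; have [M [_ [k [/andP[nk _] ck]]]] := ct n; exists k.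
Qed.

Lemma tame_descent c x : tame c -> tail_eq x c -> bounded_descent a x.
Proof. by move=> ct [m xc]; have [M mMc] := ct m; exact: confined_descent mMc xc. Qed.

Lemma tame_tail c x : tame c -> tail_eq x c -> tame x.
Proof.
move=> ct [n xc] m; have [M [feed [k [/andP[mk kM] ck]]]] := ct (maxn n m).
have nM : (n <= M)%N by lia.
exists M; split; last by exists k; rewrite xc; [split=> //|]; lia.
move=> j Mj xj y yx; apply: (feed j Mj).
  by rewrite -xc //; exact: leq_trans Mj.
exact: agree_trans (agreeW (leq_maxr _ _) yx) (agreeW (leq_maxl _ _) xc).
Qed.

(** The classes of [tail_eq] are the connected components of the address graph, so [G] is isomorphic
    to the component of [c]. *)
Definition represents (G : graph) (c : address) (f : G -> address_graph) :=
  [/\ injective f, forall u v, adj (f u) (f v) = adj u v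
    & forall x, tail_eq x c <-> exists u, f u = x].

Lemma represents_tail (G : graph) c d (f : G -> address_graph) :
  represents c f -> tail_eq c d -> represents d f.
Proof.
move=> [fi fa fc] cd; split=> // x; rewrite -fc; split=> [xd|xc].
  exact: tail_eq_trans xd (tail_eq_sym cd).
exact: tail_eq_trans xc cd.
Qed.

(** The copy of T_n in [G] consists of the preimages of the addresses that agree with [c] from n
    on. *)
Lemma represents_limit (G : graph) c (f : G -> address_graph) :
  represents c f -> limit_along a c G.
Proof.
move=> [fi fa fc].
have /choice[g gP] : forall x : address, exists u, tail_eq x c -> f u = x.
  move=> x; have [/fc[u fu]|xc] := pselect (tail_eq x c); first by exists u.
  by have /fc[u _] := tail_eq_refl c; exists u.
have gins n (v : tvertex delta n) : f (g (ins v c)) = ins v c.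
  by apply: gP; exists n; exact: ins_agree.
exists (fun n v => g (ins v c)); split.
- move=> n v w /(congr1 f); rewrite !gins => /(congr1 (fun x => pre x n)).
  by rewrite !preK.
- move=> n x; apply: fi; rewrite !gins; apply: (@address_eq _ n.+1).
    rewrite preK /=; congr (_, _); last by rewrite preK.
    by rewrite ins_agree.
  apply: agree_trans (ins_agree _ _) _; apply: agree_sym.
  by apply: agreeW (ins_agree _ _).
- move=> u; have /fc[n un] : exists v, f v = f u by exists u.
  by exists n, (pre (f u) n); apply: fi; rewrite gins ins_pre.
- move=> u v; split=> [uv|[n [x [y [<- <- xy]]]]]; last first.
    by rewrite -fa !gins adj_ins.
  have /fc[n un] : exists v, f v = f u by exists u.
  have /fc[m vm] : exists w, f w = f v by exists v.
  have {}un : agree (maxn n m) (f u) c by apply: agreeW un; exact: leq_maxl.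
  have {}vm : agree (maxn n m) (f v) c by apply: agreeW vm; exact: leq_maxr.
  exists (maxn n m), (pre (f u) (maxn n m)), (pre (f v) (maxn n m)).
  split; [by apply: fi; rewrite gins ins_pre..|].
  by rewrite -(adj_ins _ _ c) !ins_pre // fa.
Qed.

Lemma represents_dist (G : graph) c (f : G -> address_graph) r u y : represents c f ->
  dist_le r (f u) y -> exists2 v, f v = y & dist_le r u v.
Proof.
move=> [fi fa fc]; elim: r y => [|r IHr] y.
  by move=> /dist_le0_eq<-; exists u => //; exact: dist_le0.
move=> /dist_leSr_inv[/IHr[v vy uv]|[z /IHr[v vz uv] zy]].
  by exists v => //; exact: dist_leW uv.
have [w wy] : exists w, f w = y.
  apply/fc/(@tail_eq_trans _ _ z); first exact/tail_eq_sym/adj_tail.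
  by rewrite -vz; apply/fc; exists v.
by exists w => //; apply: dist_leSr uv _; rewrite -fa vz wy.
Qed.

Lemma represents_tree (G : graph) c (f : G -> address_graph) : represents c f -> is_tree G.
Proof.
move=> fr; have [fi fa fc] := fr; split.
- by have /fc[u _] := tail_eq_refl c; exists.
- move=> u v; have uc : tail_eq (f u) c by apply/fc; exists u.
  have vc : tail_eq (f v) c by apply/fc; exists v.
  have [r uv] := tail_dist a_apo (tail_eq_trans uc (tail_eq_sym vc)).
  by have [w /fi<- uw] := represents_dist fr uv; exists r.
- move=> k s s_inj sP; apply: (@address_acyclic _ _ a_apo _ (f \o s)).
    by apply: inj_comp.
  by move=> i; exact: etrans (fa _ _) (sP i).
Qed.

Lemma represents_ray (G : graph) c (f : G -> address_graph) (s : nat -> G) :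
  represents c f -> is_ray s -> is_ray (f \o s).
Proof.
move=> [fi fa fc] [s_inj sP]; split; first exact: inj_comp.
by move=> n; exact: etrans (fa _ _) (sP n).
Qed.

(** Tameness makes every ray ascend, by [ray_up], and two ascending rays merge, by [up_meet]. *)
Lemma represents_one_ended (G : graph) c (f : G -> address_graph) :
  represents c f -> tame c -> one_ended G.
Proof.
move=> fr ct; have [fi fa fc] := fr.
have ftail u : tail_eq (f u) c by apply/fc; exists u.
have up s : is_ray s -> forall n, par (f (s n)) (f (s n.+1)).
  move=> /(represents_ray fr) fs; apply: (ray_up fs) => n.
  exact/(tame_descent ct)/ftail.
split; first exact: represents_tree fr.
- have [s [s0 [s_inj sP] _]] := ancestral_ray a_apo (tame_rising ct) (tail_eq_refl c).
  have sc n : tail_eq (s n) c.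
    elim: n => [|n IHn]; first by rewrite s0; exact: tail_eq_refl.
    by apply: tail_eq_trans IHn; apply: tail_eq_sym; exact/adj_tail/sP.
  have /choice[t tP] : forall n, exists u, f u = s n by move=> n; exact/fc/sc.
  exists t; split; first by move=> m n /(congr1 f); rewrite !tP => /s_inj.
  by move=> n; rewrite -fa !tP.
- move=> s t sr tr.
  have [] := up_meet a_apo (up s sr) (up t tr).
    exact: tail_eq_trans (ftail _) (tail_eq_sym (ftail _)).
  by move=> p [q pq]; exists p, q => n; apply: fi; exact: pq.
Qed.

End confinement.

(** * Isomorphisms preserve depth *)

Section rigidity.
Variables (delta : nat -> nat) (a : attachment delta).
Hypothesis delta_gt0 : forall n, (0 < delta n.+1)%N.
Hypothesis a_apo : forall n (i : 'I_(delta n.+1)), apocentric (a i).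
Local Notation address := (address delta).
Local Notation par := (par a).
Local Notation anc := (anc a).
Local Notation address_graph := (address_graph a).

Lemma anc_dep_mod n h z x : anc h z x -> dep n z = (dep n x + h)%N %[mod 2 ^ n].
Proof.
elim: h z => [|h IHh] z; first by move=> /= ->; rewrite addn0.
move=> [y zy /IHh yx]; rewrite (par_dep_mod a_apo n zy) -addn1 -modnDml yx.
by rewrite modnDml addn1 addnS.
Qed.

(** The copy of T_m centered at [z] reaches less than 2^m below [z]. Anything hanging from one of
    its apocentric vertices starts exactly 2^m below [z], so the second clause says that nothing
    does. *)
Definition dead_end m z := dep m z = 0%N /\ forall z', ~ anc (2 ^ m) z' z.

(** If the copy of T_m were central in T_m.+1, the center of an apocentric copy would lie 2^m below
    [z]; hence bit m of [z] is set. *)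
Lemma dead_end_dep m z : dead_end m z -> dep m.+1 z = (2 ^ m)%N.
Proof.
move=> [z0 zleaf] /=; rewrite z0 add0n.
case zm: (z m) => [i|] /=; first by rewrite mul1n.
exfalso; pose w : address := dfwith z m (Some (Ordinal (delta_gt0 m))).
have wz : agree m.+1 w z by move=> k mk; rewrite /w dfwithout //; lia.
have wm : dep m w = 0%N.
  by rewrite -z0; apply: eq_dep => k km; rewrite /w dfwithout //; lia.
apply: (zleaf w); have -> : (2 ^ m)%N = dep m.+1 w.
  by rewrite /= wm /w dfwithin mul1n.
have := anc_root a_apo m.+1 w; rewrite (root_of_eq wz).
by have <- : z = root_of m.+1 z by have := anc_root a_apo m.+1 z; rewrite /= z0 zm.
Qed.

Definition leafy c := forall m, exists2 z, tail_eq z c & dead_end m z.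

Lemma leafy_tail c x : leafy c -> tail_eq x c -> leafy x.
Proof.
move=> cl xc m; have [z zc zm] := cl m; exists z => //.
exact: tail_eq_trans zc (tail_eq_sym xc).
Qed.

Section isomorphism.
Variables (x0 c : address) (f : address_graph -> address_graph).
Hypothesis f_inj : forall u v, tail_eq u x0 -> tail_eq v x0 -> f u = f v -> u = v.
Hypothesis f_adj : forall u v : address_graph, tail_eq u x0 -> tail_eq v x0 ->
  adj (f u) (f v) = adj u v.
Hypothesis f_onto : forall w, tail_eq w c <-> exists2 u, tail_eq u x0 & f u = w.
Hypotheses (x0_tame : tame a x0) (c_tame : tame a c).

(** Parents are recovered from the graph alone: the ancestral ray from [x] is mapped to a ray, and
    rays in a tame component ascend. *)
Lemma iso_par x y : tail_eq x x0 -> par x y -> par (f x) (f y).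
Proof.
move=> xx0 xy.
have [s [s0 [s_inj sP] sp]] := ancestral_ray a_apo (tame_rising x0_tame) xx0.
have s1 : s 1%N = y by apply: par_fun (sp 0%N) _; rewrite s0.
have st n : tail_eq (s n) x0.
  elim: n => [|n IHn]; first by rewrite s0.
  by apply: tail_eq_trans IHn; apply: tail_eq_sym; exact/adj_tail/sP.
have fs : is_ray (f \o s).
  split; first by move=> m n /(f_inj (st m) (st n)) /s_inj.
  by move=> n; exact: etrans (f_adj (st n) (st n.+1)) (sP n).
have := ray_up fs _ 0%N; rewrite /= s0 s1; apply=> n.
by apply: (tame_descent a_apo c_tame); apply/f_onto; exists (s n).
Qed.

Lemma iso_anc h x y : tail_eq x x0 -> anc h x y -> anc h (f x) (f y).
Proof.
elim: h x => [|h IHh] x xx0; first by move=> /= ->.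
move=> [z xz zy]; exists (f z); first exact: iso_par.
by apply: IHh zy; apply: tail_eq_trans xx0; exact: tail_eq_sym (par_tail xz).
Qed.

Lemma iso_par_inv x y : tail_eq x x0 -> tail_eq y x0 -> par (f x) (f y) -> par x y.
Proof.
move=> xx0 yx0 fxy; have : adj (f x) (f y) by apply/adj_addressE; left.
rewrite f_adj // => /adj_addressE[//|/(iso_par yx0) fyx].
exfalso; apply: (@anc_irr _ _ a_apo 1 (f x)).
by exists (f y) => //; exists (f x).
Qed.

Lemma iso_anc_inv h w x : tail_eq x x0 -> anc h w (f x) ->
  exists2 z, f z = w & anc h z x.
Proof.
move=> xx0; suff H : anc h w (f x) -> exists z, [/\ tail_eq z x0, f z = w & anc h z x].
  by move=> /H[z [_ zw zx]]; exists z.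
elim: h w => [|h IHh] w; first by move=> /= ->; exists x.
move=> [v wv /IHh[z [zx0 zv zx]]].
have /f_onto[u ux0 uw] : tail_eq w c.
  apply: tail_eq_trans (par_tail wv) _; by apply/f_onto; exists z.
exists u; split=> //; exists z => //.
by apply: iso_par_inv => //; rewrite uw zv.
Qed.

(* A dead end of T_m has depth 2^m modulo 2^m.+1, which fixes the depth of every
   other vertex modulo 2^m.+1 along the paths to a common ancestor. *)
Lemma iso_dep m x : leafy x0 -> tail_eq x x0 -> dep m (f x) = dep m x.
Proof.
move=> x0l; elim: m x => [//|m IHm] x xx0.
have [z zx0 zm] := x0l m.
have fzm : dead_end m (f z).
  split; first by rewrite IHm // zm.1.
  by move=> w /(iso_anc_inv zx0)[z' _]; exact: zm.2.
have [n xz] := tail_eq_trans xx0 (tail_eq_sym zx0).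
have xr := anc_root a_apo n x; have zr := anc_root a_apo n z.
rewrite -(root_of_eq xz) in zr; move: (root_of n x) (dep n x) (dep n z) xr zr.
move=> r h k xr zr.
have fxr := iso_anc xx0 xr; have fzr := iso_anc zx0 zr.
have /eqP := anc_dep_mod m.+1 fzr; rewrite (dead_end_dep fzm) -(dead_end_dep zm).
rewrite (anc_dep_mod m.+1 zr) eqn_modDr => /eqP rfr.
rewrite -[LHS](modn_small (dep_lt _ _)) -[RHS](modn_small (dep_lt _ _)).
rewrite (anc_dep_mod m.+1 fxr) (anc_dep_mod m.+1 xr).
by rewrite -modnDml -rfr modnDml.
Qed.

End isomorphism.

Lemma dep_inj n (x y : address) : dep n x = dep n y ->
  forall k, (k < n)%N -> isSome (x k) = isSome (y k).
Proof.
elim: n => [//|n IHn] /= e k.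
have := dep_lt n x; have := dep_lt n y => yn xn.
have en : isSome (x n) = isSome (y n) by case: (x n) (y n) e => [?|] [?|] //=; lia.
rewrite ltnS leq_eqVlt => /orP[/eqP->//|]; apply: IHn.
by move: e; rewrite en; lia.
Qed.

End rigidity.

(** * Compactness *)

Section ultrafilter_limits.

Lemma nat_ultrafilter : exists U : set_system nat,
  UltraFilter U /\ forall n, U [set r | (n <= r)%N].
Proof.
have [U [UU oU]] := @ultraFilterLemma nat \oo _.
by exists U; split=> // n; apply: oU; exact: nbhs_infty_ge.
Qed.

Variables (U : set_system nat).
Hypothesis UU : UltraFilter U.

Lemma ultra_ex (P : set nat) : U P -> exists r, P r.
Proof. by move=> /(@filter_ex _ _ (@ultra_proper _ _ UU)). Qed.

Lemma ultra_and (P Q : set nat) : U P -> U Q -> U [set r | P r /\ Q r].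
Proof. exact: (@filterI _ _ (@ultra_proper _ _ UU)). Qed.

Lemma ultraS (P Q : set nat) : P `<=` Q -> U P -> U Q.
Proof. by move=> PQ; exact: (@filterS _ _ (@ultra_proper _ _ UU)). Qed.

Lemma ultra_finite (T : Type) (A : set T) (g : nat -> T -> Prop) :
  finite_set A -> U [set r | exists2 y, A y & g r y] ->
  exists2 y, A y & U [set r | g r y].
Proof.
move=> /(@finite_seqP {classic T})[s ->] H.
suff [y ys Uy] : exists2 y : {classic T}, y \in s & U [set r | g r y] by exists y.
elim: s H => [/ultra_ex[r [y]]//|y s IHs] H.
have [Uy|nUy] := in_ultra_setVsetC [set r | g r y] UU.
  by exists y; rewrite ?mem_head.
have [|z zs Uz] := IHs; last by exists z; rewrite // inE zs orbT.
apply: ultraS (ultra_and H nUy) => r /= [[z zs rz] ry].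
by move: zs => /=; rewrite inE => /orP[/eqP zy|zs]; [rewrite zy in rz|exists z].
Qed.

End ultrafilter_limits.

(** Each coordinate has finitely many values, hence a limit along the ultrafilter, and finitely many
    coordinates attain their limits together at arbitrarily late r. *)
Lemma address_cluster (delta : nat -> nat) (x : nat -> address delta) :
  exists c, forall n, exists2 r, (n <= r)%N & pre (x r) n = pre c n.
Proof.
have [U [UU Uge]] := nat_ultrafilter.
have H k : exists y, U [set r | x r k = y].
  have fT : finite_set [set: option 'I_(delta k.+1)] by exact: finite_finset.
  have [|y _ Uy] := @ultra_finite U UU _ _ (fun r y => x r k = y) fT; last by exists y.
  by apply: (ultraS UU) (Uge 0%N) => r _; exists (x r k).
exists (fun k => sval (cid (H k))) => n.
suff /(ultra_and UU (Uge n))/(ultra_ex UU)[r [nr rn]] :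
  U [set r | pre (x r) n = pre (fun k => sval (cid (H k))) n] by exists r.
elim: n => [|n IHn]; first by apply: (ultraS UU) (Uge 0%N).
apply: (ultraS UU) (ultra_and UU IHn (svalP (cid (H n)))) => r [rn rk].
exact: congr2 rk rn.
Qed.

(** * Rooted graphs with isomorphic balls of every radius *)

Section ball_maps.

Definition in_component (G : graph) (o u : G) := exists r, dist_le r o u.

(** Ball isomorphisms are taken as relations on the ambient graphs: they are inverted by swapping
    arguments, and vertices carry no distance proofs. *)
Record ball_map (G : graph) (o : G) (H : graph) (eta : H) r (rho : G -> H -> Prop)
  : Prop := BallMap {
  bm_root : rho o eta;
  bm_dom : forall u y, rho u y -> dist_le r o u;
  bm_cod : forall u y, rho u y -> dist_le r eta y;
  bm_total : forall u, dist_le r o u -> exists y, rho u y;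
  bm_onto : forall y, dist_le r eta y -> exists u, rho u y;
  bm_fun : forall u y z, rho u y -> rho u z -> y = z;
  bm_inj : forall u v y, rho u y -> rho v y -> u = v;
  bm_adj : forall u v y z, rho u y -> rho v z -> adj u v = adj y z }.

Lemma ball_map_sym (G : graph) (o : G) (H : graph) (eta : H) r rho :
  ball_map o eta r rho -> ball_map eta o r (fun y u => rho u y).
Proof.
move=> [r0 rd rc rt ro rf ri ra]; split=> //.
- by move=> u y; exact: rc.
- by move=> u y; exact: rd.
- by move=> u y z uy uz; exact: ri uy uz.
- by move=> u v y uy vy; exact: rf uy vy.
- by move=> u v y z uy vz; rewrite (ra y z u v).
Qed.

Lemma ball_iso_map (G : graph) (o : G) (H : graph) (eta : H) r :
  ball_iso o r (ball_root eta r) -> exists rho, ball_map o eta r rho.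
Proof.
move=> [F [[F' FK F'K] Fadj Fo]].
exists (fun u y => exists p : dist_le r o u, sval (F (exist _ u p)) = y); split.
- by exists (ball_root_subproof o r); exact: (congr1 (@sval _ _) Fo).
- by move=> u y [].
- by move=> u y [p <-]; exact: svalP.
- by move=> u p; eexists; exists p.
- move=> y p; case E: (F' (exist _ y p)) => [u q]; exists u, q.
  by have := congr1 F E; rewrite F'K => <-.
- move=> u y z [p <-] [q <-]; congr (sval (F _)); exact: sval_inj.
- move=> u v y [p <-] [q /esym/sval_inj /(can_inj FK) e].
  by case: e.
- move=> u v y z [p <-] [q <-]; have := Fadj (exist _ u p) (exist _ v q).
  by rewrite /= /ball_adj /= => ->.
Qed.

Lemma ball_map_dist (G : graph) (o : G) (H : graph) (eta : H) r rho s u y :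
  ball_map o eta r rho -> (s <= r)%N -> rho u y -> dist_le s o u -> dist_le s eta y.
Proof.
move=> bm; elim: s u y => [|s IHs] u y sr uy.
  move=> /dist_le0_eq ou; rewrite -ou in uy.
  by rewrite (bm_fun bm uy (bm_root bm)); exact: dist_le0.
move=> /dist_leSr_inv[ou|[v ov vu]].
  by apply: (@dist_leW _ s) => //; apply: IHs uy ou; exact: ltnW.
have [z vz] := bm_total bm (dist_leW (ltnW sr) ov).
apply: (@dist_leSr _ s _ z); first by apply: IHs vz ov; exact: ltnW.
by rewrite -(bm_adj bm vz uy).
Qed.

Lemma ball_map_finite (G : graph) (o : G) (H : graph) (eta : H) r rho :
  ball_map o eta r rho -> finite_set [set y | dist_le r eta y] ->
  finite_set [set u | dist_le r o u].
Proof.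
move=> bm fH.
have /choice[g gP] : forall y, exists u, dist_le r eta y -> rho u y.
  move=> y; have [/(bm_onto bm)[u uy]|ny] := pselect (dist_le r eta y).
    by exists u.
  by exists o.
apply: sub_finite_set (finite_image g fH) => u ou.
have [y uy] := bm_total bm ou; have ey := bm_cod bm uy.
by exists y => //; apply: (bm_inj bm) uy; exact: gP.
Qed.

Section limit.
Variables (G : graph) (o : G) (H : graph) (eta : H) (rho : nat -> G -> H -> Prop).
Hypothesis bm : forall r, ball_map o eta r (rho r).
Variables (U : set_system nat).
Hypotheses (UU : UltraFilter U) (Uge : forall n, U [set r | (n <= r)%N]).

Definition limit_rel u y := U [set r | rho r u y].

Lemma limit_fun u y z : limit_rel u y -> limit_rel u z -> y = z.
Proof.
move=> uy uz; have [r [ry rz]] := ultra_ex UU (ultra_and UU uy uz).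
exact: (bm_fun (bm r) ry rz).
Qed.

Lemma limit_adj u v y z : limit_rel u y -> limit_rel v z -> adj u v = adj y z.
Proof.
move=> uy vz; have [r [ry rz]] := ultra_ex UU (ultra_and UU uy vz).
exact: (bm_adj (bm r) ry rz).
Qed.

(** For r >= s the image of [u] stays in the finite ball of radius s, so the ultrafilter selects one
    value. *)
Lemma limit_total s u : finite_set [set y | dist_le s eta y] -> dist_le s o u ->
  exists2 y, dist_le s eta y & limit_rel u y.
Proof.
move=> fH ou; apply: (ultra_finite UU) => //.
apply: (ultraS UU) (Uge s) => r sr.
have [y uy] := bm_total (bm r) (dist_leW sr ou).
by exists y => //; exact: (ball_map_dist (bm r) sr uy ou).
Qed.

End limit.

(* The isomorphism is an ultrafilter limit of isomorphisms of balls. *)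
Lemma local_iso_component (G : graph) (o : G) (H : graph) (eta : H) :
  (forall r, ball_iso o r (ball_root eta r)) ->
  (forall r, finite_set [set y | dist_le r eta y]) ->
  exists f : G -> H,
    [/\ f o = eta,
       forall u v, in_component o u -> in_component o v -> f u = f v -> u = v,
       forall u v, in_component o u -> in_component o v -> adj (f u) (f v) = adj u v
     & forall y, in_component eta y <-> exists2 u, in_component o u & f u = y].
Proof.
move=> iso fH; have /choice[rho bm] : forall r, exists rho, ball_map o eta r rho.
  by move=> r; exact: ball_iso_map.
have [U [UU Uge]] := nat_ultrafilter.
have fG r := ball_map_finite (bm r) (fH r).
have bm' r := ball_map_sym (bm r).
have /choice[f fP] : forall u, exists y, in_component o u ->
    in_component eta y /\ limit_rel rho U u y.
  move=> u; have [[s ou]|nu] := pselect (in_component o u); last by exists eta.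
  have [y ey uy] := limit_total bm UU Uge (fH s) ou.
  by exists y => _; split=> //; exists s.
have o0 : in_component o o by exists 0%N; exact: dist_le0.
exists f; split.
- apply: (limit_fun bm UU (fP o o0).2); apply: (ultraS UU) (Uge 0%N) => r _.
  exact: bm_root.
- move=> u v uo vo fuv; have := (fP u uo).2; rewrite fuv => uv.
  exact: (limit_fun bm' UU) uv (fP v vo).2.
- by move=> u v uo vo; rewrite (limit_adj bm UU (fP u uo).2 (fP v vo).2).
- move=> y; split=> [[s ys]|[u uo <-]]; last exact: (fP u uo).1.
  have [u us uy] := limit_total bm' UU Uge (fG s) ys.
  have uo : in_component o u by exists s.
  by exists u => //; exact: (limit_fun bm UU (fP u uo).2 uy).
Qed.

(** A path of length at most r from [f o] meets only vertices of the image, so it lifts to [G];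
    distances to the root up to r are thus the same on both sides. *)
Lemma ball_iso_embedding (G : graph) (o : G) (H : graph) (f : G -> H) r :
  injective f -> (forall u v, adj (f u) (f v) = adj u v) ->
  (forall y, dist_le r (f o) y -> exists u, f u = y) ->
  ball_iso o r (ball_root (f o) r).
Proof.
move=> f_inj f_adj f_onto.
have lift s y : (s <= r)%N -> dist_le s (f o) y -> exists2 u, f u = y & dist_le s o u.
  elim: s y => [|s IHs] y sr.
    by move=> /dist_le0_eq<-; exists o => //; exact: dist_le0.
  move=> oy; have [u uy] := f_onto _ (dist_leW sr oy).
  move: oy => /dist_leSr_inv[/(IHs _ (ltnW sr))[v vy ov]|[z /(IHs _ (ltnW sr))[v vz ov] zy]].
    by exists v => //; exact: dist_leW ov.
  by exists u => //; apply: dist_leSr ov _; rewrite -f_adj vz uy.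
have fP (v : ball_graph o r) : dist_le r (f o) (f (sval v)).
  by apply: dist_le_map => //; exact: (svalP v).
have gP (y : ball_graph (f o) r) : exists u : ball_graph o r, f (sval u) = sval y.
  have [u uy ou] := lift r _ (leqnn r) (svalP y).
  by exists (exist _ u ou).
exists (fun v => exist _ _ (fP v)); split.
- exists (fun y => sval (cid (gP y))) => v; apply: sval_inj.
    by apply: f_inj; case: cid.
  by rewrite /=; case: cid.
- by move=> u v; exact: f_adj.
- exact: sval_inj.
Qed.

End ball_maps.

(** * Null sets of addresses *)

Section counting.
Variables (R : realType) (delta : nat -> nat).
Local Notation address := (address delta).

Definition none_address : address := fun _ => None.

Lemma card_tvertexS n :
  #|tvertex delta n.+1| = ((delta n.+1).+1 * #|tvertex delta n|)%N.
Proof. by rewrite /= card_prod card_option card_ord. Qed.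

Lemma card_tvertex_gt0 n : (0 < #|tvertex delta n|)%N.
Proof. by elim: n => [|n IHn]; [rewrite card_unit|rewrite card_tvertexS muln_gt0]. Qed.

Definition frac n (B : {set tvertex delta n}) : R :=
  #|B|%:R / #|tvertex delta n|%:R.

Lemma card_neq0 n : (#|tvertex delta n|%:R : R) != 0.
Proof. by rewrite pnatr_eq0 -lt0n card_tvertex_gt0. Qed.

Lemma frac_ge0 n (B : {set tvertex delta n}) : 0 <= frac B.
Proof. by rewrite divr_ge0 ?ler0n. Qed.

Lemma frac_le n (B C : {set tvertex delta n}) : B \subset C -> frac B <= frac C.
Proof.
by move=> BC; rewrite ler_wpM2r ?invr_ge0 ?ler0n // ler_nat subset_leq_card.
Qed.

Lemma frac_setU n (B C : {set tvertex delta n}) :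
  frac (B :|: C)%SET <= frac B + frac C.
Proof.
by rewrite -mulrDl ler_wpM2r ?invr_ge0 ?ler0n // -natrD ler_nat leq_card_setU.
Qed.

Lemma frac_setU_disjoint n (B C : {set tvertex delta n}) :
  (B :&: C)%SET = finset.set0 -> frac (B :|: C)%SET = frac B + frac C.
Proof. by move=> BC; rewrite -mulrDl -natrD -cardsUI BC cards0 addn0. Qed.

Lemma frac_set0 n : frac (finset.set0 : {set tvertex delta n}) = 0.
Proof. by rewrite /frac cards0 mul0r. Qed.

Lemma frac_setC n (B : {set tvertex delta n}) : frac (~: B)%SET = 1 - frac B.
Proof.
apply/eqP; rewrite eq_sym subr_eq -mulrDl -natrD addnC cardsC mulfV //.
exact: card_neq0.
Qed.

Lemma frac_bigcup N n (B : 'I_N -> {set tvertex delta n}) :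
  frac (\bigcup_(m < N) B m)%SET <= \sum_(m < N) frac (B m).
Proof.
elim: N B => [|N IHN] B; first by rewrite !big_ord0 frac_set0.
rewrite !big_ord_recr /=; apply: le_trans (frac_setU _ _) _.
by rewrite lerD2r.
Qed.

(** The cylinder over [B], seen at level N >= n; [none_address] only fills coordinates that are not
    read. *)
Definition lift_set n N (B : {set tvertex delta n}) : {set tvertex delta N} :=
  [set w | pre (ins w none_address) n \in B]%SET.

Lemma pre_ins_pre n N (x c : address) : (n <= N)%N ->
  pre (ins (pre x N) c) n = pre x n.
Proof.
move=> nN; apply/eq_pre => k kn.
by have /eq_pre -> // := preK (pre x N) c; exact: leq_trans nN.
Qed.

Lemma lift_set_pre n N (B : {set tvertex delta n}) (x : address) : (n <= N)%N ->
  (pre x N \in lift_set N B) = (pre x n \in B).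
Proof. by move=> nN; rewrite inE pre_ins_pre. Qed.

Lemma frac_setX n (I : {set option 'I_(delta n.+1)}) (B : {set tvertex delta n}) :
  @frac n.+1 (finset.setX I B) = #|I|%:R / (delta n.+1).+1%:R * frac B.
Proof.
rewrite /frac (_ : #|finset.setX I B| = (#|I| * #|B|)%N); last exact: cardsX.
by rewrite card_tvertexS !natrM mulf_div.
Qed.

Lemma frac_lift n N (B : {set tvertex delta n}) : (n <= N)%N ->
  frac (lift_set N B) = frac B.
Proof.
elim: N => [|N IHN].
  rewrite leqn0 => /eqP n0; subst n; congr frac; apply/setP => w.
  by rewrite -[w](preK _ none_address) lift_set_pre.
rewrite leq_eqVlt => /orP[/eqP nN|].
  subst n; congr frac; apply/setP => w.
  by rewrite -[w](preK _ none_address) lift_set_pre.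
rewrite ltnS => nN; rewrite -(IHN nN).
have -> : lift_set N.+1 B = finset.setX [set: _]%SET (lift_set N B).
  apply/setP => w; rewrite -[w](preK _ none_address) lift_set_pre ?leqW //.
  by rewrite /= finset.in_setX finset.in_setT /= lift_set_pre.
by rewrite frac_setX cardsT card_option card_ord mulfV ?mul1r // pnatr_eq0.
Qed.

Lemma pre_le n N (x y : address) : (n <= N)%N -> pre x N = pre y N -> pre x n = pre y n.
Proof.
by move=> nN /eq_pre xy; apply/eq_pre => k kn; apply: xy; exact: leq_trans nN.
Qed.

(* Outer measure at most [e] for the product of the uniform measures: [A] is
   covered by cylinders of total mass at most [e]. *)
Definition thin (e : R) (A : set address) := exists B : forall n, {set tvertex delta n},
  (forall c, A c -> exists n, pre c n \in B n) /\
  forall N, \sum_(n < N) frac (B n) <= e.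

Lemma thin_subset e A A' : A `<=` A' -> thin e A' -> thin e A.
Proof. by move=> AA' [B [AB Be]]; exists B; split=> // c /AA'; exact: AB. Qed.

(* Compactness: finitely many of the covering cylinders already cover a cylinder. *)
Lemma thin_count e A n : thin e A ->
  frac [set v : tvertex delta n | `[< forall c, pre c n = v -> A c >]]%SET <= e.
Proof.
move=> [B [AB Be]]; set W := [set _ | _]%SET.
have WA c : pre c n \in W -> A c by rewrite inE => /asboolP; apply.
have [N NP] : exists N, forall c, pre c n \in W ->
    exists2 m, (m < N)%N & pre c m \in B m.
  (* Otherwise addresses in [W] that avoid the first N levels of the cover cluster at an address in
     [W] outside all cylinders. *)
  apply: contrapT => /forallNP H.
  have /choice[x xP] : forall N, exists c, pre c n \in W /\
      forall m, (m < N)%N -> pre c m \notin B m.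
    move=> N; have /existsNP[c /not_implyP[cW cB]] := H N.
    exists c; split=> // m mN; apply/negP => cm; apply: cB; by exists m.
  have [c cP] := address_cluster x.
  have [r _ rn] := cP n; have cW : pre c n \in W by rewrite -rn; exact: (xP r).1.
  have [m cm] := AB c (WA c cW).
  have [s ms sm] := cP m.+1.
  by have := (xP s).2 m ms; rewrite (pre_le (leqnSn m) sm) cm.
pose M := maxn n N.
rewrite -(frac_lift W (leq_maxl n N)) -/M; apply: le_trans (Be M).
apply: le_trans (_ : \sum_(m < M) frac (lift_set M (B m)) <= _); last first.
  by apply: ler_sum => m _; rewrite frac_lift // ltnW.
apply: le_trans (frac_bigcup _); apply: frac_le; apply/fintype.subsetP => w.
rewrite -[w](preK _ none_address) lift_set_pre ?leq_maxl // => /NP[m mN cm].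
have mM : (m < M)%N by apply: leq_trans mN _; exact: leq_maxr.
by apply/finset.bigcupP; exists (Ordinal mM) => //; rewrite lift_set_pre // ltnW.
Qed.

(** The covers are merged level by level. Each level has finitely many vertices, so finitely many
    covers account for the first N levels, and their weights sum to at most e. *)
Lemma thin_bigcup e (A : nat -> set address) : 0 <= e ->
  (forall k, thin (e / 2 ^+ k.+1) (A k)) -> thin e (\bigcup_k A k).
Proof.
move=> e0 /choice[B BP].
exists (fun n => [set v | `[< exists k, v \in B k n >]]%SET); split.
  move=> c [k _ ck]; have [n cn] := (BP k).1 c ck; exists n.
  by rewrite inE; apply/asboolP; exists k.
move=> N; pose C n := [set v : tvertex delta n | `[< exists k, v \in B k n >]]%SET.
have /choice[K KP] : forall n : 'I_N, exists K, C n \subset (\bigcup_(k < K) B k n)%SET.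
  move=> n; have /choice[g gP] : forall v, exists k, v \in C n -> v \in B k n.
    move=> v; have [vC|] := boolP (v \in C n); last by exists 0%N.
    by move: (vC); rewrite inE => /asboolP[k vk]; exists k.
  exists (\max_v (g v).+1)%N; apply/fintype.subsetP => v vC.
  have gv : (g v < \max_v (g v).+1)%N by exact: (@leq_bigmax _ (fun v => (g v).+1) v).
  by apply/finset.bigcupP; exists (Ordinal gv) => //; exact: gP.
pose M := (\max_n K n)%N.
have KM (n : 'I_N) : C n \subset (\bigcup_(k < M) B k n)%SET.
  apply: (fintype.subset_trans (KP n)); apply/finset.bigcupsP => k _.
  have kM : (k < M)%N by apply: leq_trans (ltn_ord k) _; exact: leq_bigmax.
  by apply/fintype.subsetP => v vk; apply/finset.bigcupP; exists (Ordinal kM).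
apply: le_trans (_ : \sum_(n < N) \sum_(k < M) frac (B k n) <= _).
  by apply: ler_sum => n _; apply: le_trans (frac_le (KM n)) (frac_bigcup _).
rewrite exchange_big /=; apply: le_trans (_ : \sum_(k < M) e / 2 ^+ k.+1 <= _).
  by apply: ler_sum => k _; exact: (BP k).2.
rewrite -mulr_sumr; suff -> : \sum_(k < M) (2 ^+ k.+1)^-1 = 1 - (2 ^+ M)^-1 :> R.
  by rewrite mulrBr mulr1 gerBl mulr_ge0 // invr_ge0 exprn_ge0.
elim: (M) => [|m IHm]; first by rewrite big_ord0 expr0 invr1 subrr.
rewrite big_ord_recr /= IHm exprS invfM.
set t := (2 ^+ m)^-1; lra.
Qed.

Definition box (p : forall k, pred (option 'I_(delta k.+1))) n : {set tvertex delta n} :=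
  [set v | [forall k : 'I_n, p k (ins v none_address k)]]%SET.

Lemma box_pre p n x : pre x n \in box p n <-> forall k, (k < n)%N -> p k (x k).
Proof.
have E k : (k < n)%N -> ins (pre x n) none_address k = x k.
  by have /eq_pre := preK (pre x n) none_address; apply.
rewrite inE; split=> [/forallP H k kn|H].
  by have := H (Ordinal kn); rewrite /= E.
by apply/forallP => k; rewrite E // H.
Qed.

Lemma card_box p n : #|box p n| = (\prod_(k < n) #|p k|)%N.
Proof.
elim: n => [|n IHn].
  rewrite big_ord0 (_ : box p 0 = [set: _]%SET) ?cardsT ?card_unit //.
  by apply/setP => v; rewrite !inE; apply/forallP => -[].
rewrite big_ord_recr /= -IHn mulnC.
have -> : box p n.+1 = finset.setX [set i | p n i]%SET (box p n).
  apply/setP => v; rewrite -[v](preK _ none_address).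
  set x := ins v none_address; rewrite [in RHS]/= finset.in_setX inE.
  apply/idP/andP => [/box_pre H|[pn /box_pre H]].
    by split; [exact: H|apply/box_pre => k kn; apply: H; exact: ltnW].
  by apply/box_pre => k; rewrite ltnS leq_eqVlt => /orP[/eqP->|/H].
by rewrite cardsX cardsE.
Qed.

Lemma frac_box p n : frac (box p n) = \prod_(k < n) (#|p k|%:R / (delta k.+1).+1%:R).
Proof.
rewrite /frac card_box; elim: n => [|n IHn].
  by rewrite !big_ord0 card_unit divr1.
by rewrite !big_ord_recr /= card_tvertexS natrM mulnC natrM -mulf_div IHn mulrC.
Qed.

End counting.

(** * Unconfined addresses have small mass *)

Section thin_sets.
Variables (R : realType) (delta : nat -> nat).
Hypothesis delta_ge2 : forall n, (2 <= delta n.+1)%N.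
Local Notation address := (address delta).
Local Notation thin := (@thin R delta).

Lemma thin_setU e1 e2 A1 A2 : thin e1 A1 -> thin e2 A2 -> thin (e1 + e2) (A1 `|` A2).
Proof.
move=> [B1 [AB1 Be1]] [B2 [AB2 Be2]]; exists (fun n => B1 n :|: B2 n)%SET; split.
  by move=> c [/AB1|/AB2] [n cn]; exists n; rewrite finset.in_setU cn ?orbT.
move=> N; apply: le_trans (lerD (Be1 N) (Be2 N)); rewrite -big_split /=.
by apply: ler_sum => n _; exact: frac_setU.
Qed.

Lemma thin_box e p M : frac R (box p M) <= e ->
  thin e [set c | forall k, (k < M)%N -> p k (c k)].
Proof.
move=> pe; exists (fun n => if n == M then box p n else finset.set0); split.
  by move=> c cp; exists M; rewrite eqxx; apply/box_pre.
move=> N; have [MN|NM] := ltnP M N.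
  rewrite (bigD1 (Ordinal MN)) //= eqxx big1 ?addr0 // => i /negPf iM.
  by rewrite -val_eqE /= in iM; rewrite iM frac_set0.
rewrite big1; first by apply: le_trans pe; exact: frac_ge0.
by move=> i _; rewrite ltn_eqF ?frac_set0 //; exact: leq_trans NM.
Qed.

(** The event at stage j is a cylinder of level j.+1, in which the coordinate [None] contributes the
    factor 1 / (delta + 1). *)
Lemma thin_stages e M (G : forall j, {set tvertex delta j}) :
  (forall N, \sum_(j < N | (M <= j)%N) frac R (G j) / (delta j.+1).+1%:R <= e) ->
  thin e [set c | exists j, [/\ (M <= j)%N, c j = None & pre c j \in G j]].
Proof.
move=> He; exists (fun n => match n return {set tvertex delta n} with
  | 0 => finset.set0
  | j.+1 => if (M <= j)%N then finset.setX [set None]%SET (G j) else finset.set0 end).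
split.
  move=> c [j [Mj cj cG]]; exists j.+1; rewrite Mj /= finset.in_setX cG andbT.
  by rewrite cj inE.
case=> [|N]; first by have := He 0%N; rewrite !big_ord0.
rewrite big_ord_recl frac_set0 add0r; apply: le_trans (He N).
rewrite [leRHS]big_mkcond; apply: ler_sum => j _ /=.
case: ifP => _; last by rewrite frac_set0.
by rewrite frac_setX cards1 mul1r mulrC.
Qed.

Lemma geometric_tail M N :
  \sum_(j < N | (M <= j)%N) (2 / 3) ^+ j <= 3 * (2 / 3) ^+ M :> R.
Proof.
suff : \sum_(j < N | (M <= j)%N) (2 / 3) ^+ j + 3 * (2 / 3) ^+ maxn M N
    = 3 * (2 / 3) ^+ M :> R.
  move=> <-; rewrite lerDl mulr_ge0 // exprn_ge0 // divr_ge0 //.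
elim: N => [|N IHN]; first by rewrite big_ord0 add0r maxn0.
rewrite big_mkcond big_ord_recr -big_mkcond /=.
have [MN|NM] := leqP M N; last by rewrite -IHN addr0 !(maxn_idPl _) // ltnW.
rewrite -IHN (maxn_idPr MN) (maxn_idPr (leqW MN)) exprS.
by set t := (2 / 3) ^+ N; set s := \sum_(_ < _ | _) _; lra.
Qed.

Lemma small_pow (q e : R) : 0 <= q < 1 -> 0 < e ->
  exists M, forall n, (M <= n)%N -> q ^+ n <= e.
Proof.
move=> /andP[q0 q1] e0.
have q1' : `|q| < 1 by rewrite ger0_norm.
have /cvgrPdist_le /(_ e e0) [M _ HM] := cvg_expr q1'.
exists M => n Mn; have := HM n Mn; rewrite /= sub0r normrN ger0_norm //.
by rewrite exprn_ge0.
Qed.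

Lemma card_tvertex_ge n : (3 ^ n <= #|tvertex delta n|)%N.
Proof.
elim: n => [|n IHn]; first by rewrite card_unit.
by rewrite card_tvertexS expnS leq_mul // ltnS.
Qed.

(** A rearrangement of prod (1 + t k) >= 1 + sum t k; it turns a divergent series into a vanishing
    product. *)
Lemma prod_inv_le (t : nat -> R) M : (forall k, 0 <= t k) ->
  (\prod_(k < M) (1 + t k)^-1) * (1 + \sum_(k < M) t k) <= 1.
Proof.
move=> t0; elim: M => [|M IHM]; first by rewrite !big_ord0 addr0 mulr1.
rewrite !big_ord_recr /=.
set P := \prod_(i < M) _ in IHM *; set S := \sum_(i < M) _ in IHM *.
have S0 : 0 <= S by exact: sumr_ge0.
have tM : 0 < 1 + t M by rewrite ltr_pwDl.
have P0 : 0 <= P by apply: prodr_ge0 => k _; rewrite invr_ge0 addr_ge0.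
apply: le_trans IHM; rewrite -mulrA ler_wpM2l // mulrC ler_pdivrMr //.
have := t0 M; have : 0 <= S * t M by rewrite mulr_ge0.
rewrite mulrDr mulr1 mulrDl mul1r; lra.
Qed.

Lemma prod_tail (q : R) m M :
  \prod_(k < M) (if (m <= k)%N then q else 1) = q ^+ (M - m).
Proof.
elim: M => [|M IHM]; first by rewrite big_ord0 sub0n expr0.
rewrite big_ord_recr /= IHM; case: leqP => mM; first by rewrite subSn // exprSr.
by rewrite mulr1; congr (q ^+ _); lia.
Qed.

Lemma card_isSome k : #|[pred i : option 'I_(delta k.+1) | isSome i]| = delta k.+1.
Proof.
have := cardC [pred i : option 'I_(delta k.+1) | isSome i].
rewrite card_option card_ord -[RHS]addn1 (_ : #|predC _| = 1%N).
  by move=> /eqP; rewrite eqn_add2r => /eqP.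
by rewrite -(card1 (None : option 'I_(delta k.+1))); apply: eq_card => -[i|].
Qed.

Lemma delta_inv k : ((delta k.+1)%:R / (delta k.+1).+1%:R : R)
  = (1 + (delta k.+1)%:R^-1)^-1.
Proof.
have d0 : ((delta k.+1)%:R : R) != 0 by rewrite pnatr_eq0; have := delta_ge2 k; lia.
have -> : 1 + (delta k.+1)%:R^-1 = (delta k.+1).+1%:R / (delta k.+1)%:R :> R.
  by rewrite -natr1 mulrDl mulfV // mul1r.
by rewrite invfM invrK mulrC.
Qed.

Section attachments.
Variable a : attachment delta.
Hypothesis a_apo : forall n (i : 'I_(delta n.+1)), apocentric (a i).

(** Confinement fails only if a feeder occurs at a central stage j >= M ([A1]) or if all coordinates
    from m to M are [None] ([A2]). *)
Lemma thin_unconfined m e : 0 < e ->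
  exists M, thin e [set c | ~ confined a m M c].
Proof.
move=> e0; have e2 : 0 < e / 2 by rewrite divr_gt0.
pose C : R := #|tvertex delta m|%:R.
have C0 : 0 < C by rewrite ltr0n card_tvertex_gt0.
have [M1 HM1] : exists M, forall n, (M <= n)%N -> (2 / 3) ^+ n <= e / 2 / (3 * C).
  by apply: small_pow; [lra|rewrite divr_gt0 // mulr_gt0].
have [M2 HM2] : exists M, forall n, (M <= n)%N -> (1 / 3) ^+ n <= e / 2.
  by apply: small_pow => //; lra.
pose M := (M1 + (m + M2))%N; exists M; rewrite [e]splitr.
(* Confinement concerns the whole copy of T_m at [c], so the first m coordinates of a feeder are
   made arbitrary, at the cost of a factor [C]. *)
pose G j : {set tvertex delta j} := [set pre (ins p.1 (ins p.2 (none_address delta))) j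
  | p in finset.setX [set: tvertex delta m]%SET (feeders a j)]%SET.
pose A1 := [set c | exists j, [/\ (M <= j)%N, c j = None & pre c j \in G j]].
pose A2 := [set c : address | forall k, (k < M)%N -> (m <= k)%N ==> (c k == None)].
have A1_thin : thin (e / 2) A1.
  apply: thin_stages => N.
  (* T_j has at least 3^j vertices, so stage j has mass at most C delta 2^j / ((delta + 1) 3^j). *)
  apply: le_trans (_ : \sum_(j < N | (M <= j)%N) C * (2 / 3) ^+ j <= _).
    apply: ler_sum => j _; rewrite /frac -mulrA -invfM -natrM.
    rewrite ler_pdivrMr ?ltr0n ?muln_gt0 ?card_tvertex_gt0 //.
    rewrite expr_div_n -!natrX -!mulrA [_^-1 * _]mulrC.
    have cG : (#|G j| <= #|tvertex delta m| * (delta j.+1 * 2 ^ j))%N.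
      apply: leq_trans (leq_imset_card _ _) _; rewrite cardsX cardsT leq_mul2l.
      by rewrite card_feeders orbT.
    apply: le_trans (_ : C * ((delta j.+1 * 2 ^ j)%N)%:R <= _).
      by rewrite -natrM ler_nat.
    rewrite ler_wpM2l ?(ltW C0) // [(delta _ * _)%N]mulnC natrM.
    rewrite ler_wpM2l ?ler0n // ler_pdivlMr ?ltr0n ?expn_gt0 // -natrM ler_nat.
    by rewrite mulnC leq_mul // card_tvertex_ge.
  rewrite -mulr_sumr; apply: le_trans (ler_wpM2l (ltW C0) (geometric_tail _ _)) _.
  have := HM1 M (leq_addr _ _); rewrite ler_pdivlMr ?mulr_gt0 //.
  by rewrite mulrCA mulrA mulrC.
have A2_thin : thin (e / 2) A2.
  apply: (thin_box (p := fun k i => (m <= k)%N ==> (i == None))).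
  rewrite frac_box; apply: le_trans (HM2 (M - m)%N _); last first.
    by rewrite /M; lia.
  (* A [None] has mass 1 / (delta + 1) <= 1 / 3, as delta >= 2. *)
  apply: le_trans (_ : \prod_(k < M) (if (m <= k)%N then 1 / 3 else 1) <= _).
    apply: ler_prod => k _; rewrite divr_ge0 ?ler0n //=.
    case: ifP => mk.
      rewrite (eq_card (B := pred1 None)); last by [].
      by rewrite card1 ler_pM // ?invr_ge0 ?ler0n // lef_pV2 ?posrE ?ltr0n // ler_nat ltnS.
    rewrite (eq_card (B := predT)); last by [].
    by rewrite card_option card_ord divff ?pnatr_eq0.
  by rewrite prod_tail.
apply: thin_subset (thin_setU A1_thin A2_thin).
move=> c /= nmc; apply: contrapT => /not_orP[nA1 nA2]; apply: nmc; split.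
  move=> j Mj cj x xc; apply/negP => xj; apply: nA1; exists j; split=> //.
  apply/imsetP; exists (pre c m, pre x j); first by rewrite finset.in_setX inE xj.
  apply/eq_pre => k kj /=; have [km|mk] := ltnP k m.
    by have /eq_pre -> := preK (pre c m) (ins (pre x j) (none_address delta)).
  rewrite ins_agree //; have /eq_pre -> // := preK (pre x j) (none_address delta).
  by rewrite xc.
apply: contrapT => H; apply: nA2 => k kM; apply/implyP => mk.
case E: (c k) => [i|//]; exfalso; apply: H; exists k; rewrite mk kM E.
by [].
Qed.

End attachments.
End thin_sets.

(** * The series of reciprocals of [delta] *)

Section growth.
Variables (R : realType) (delta : nat -> nat).
Hypothesis delta_ge2 : forall n, (2 <= delta n.+1)%N.
Local Notation address := (address delta).
Local Notation thin := (@thin R delta).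
Local Notation psum N := (\sum_(k < N) ((delta k.+1)%:R^-1 : R)).

Lemma series_psum N :
  (\sum_(1 <= n < N.+1) ((delta n)%:R^-1 : R)%:E = (psum N)%:E)%E.
Proof. by rewrite big_add1 big_mkord sumEFin. Qed.

Lemma series_le b : (forall N, psum N <= b) ->
  (\sum_(1 <= n <oo) ((delta n)%:R^-1 : R)%:E <= b%:E)%E.
Proof.
move=> H; apply: lime_le.
  by apply: is_cvg_nneseries => n _ _; rewrite lee_fin invr_ge0.
apply: nearW => -[|N]; last by rewrite series_psum lee_fin.
by rewrite big_geq // lee_fin; have := H 0%N; rewrite big_ord0.
Qed.

Lemma psum_unbounded :
  (\sum_(1 <= n <oo) ((delta n)%:R^-1 : R)%:E = +oo)%E ->
  forall b, exists N, b <= psum N.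
Proof.
move=> Hoo b; apply: contrapT => /forallNP H.
have bN N : psum N <= b by have /negP := H N; rewrite -ltNge => /ltW.
by have := series_le bN; rewrite Hoo leye_eq.
Qed.

Lemma psum_tail :
  (\sum_(1 <= n <oo) ((delta n)%:R^-1 : R)%:E < +oo)%E ->
  forall e, 0 < e -> exists M, forall N,
    \sum_(k < N | (M <= k)%N) ((delta k.+1)%:R^-1 : R) <= e.
Proof.
move=> Hoo e e0; set S := (limn _) in Hoo.
have S0 : (0 <= S)%E by apply: nneseries_ge0 => n _ _; rewrite lee_fin invr_ge0.
have Sfin : S \is a fin_num by rewrite ge0_fin_numE.
have Sle N : psum N <= fine S.
  rewrite -lee_fin fineK // -series_psum.
  by apply: nneseries_lim_ge => n _ _; rewrite lee_fin invr_ge0.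
have [M HM] : exists M, fine S - e < psum M.
  apply: contrapT => /forallNP H.
  have Sb N : psum N <= fine S - e by have /negP := H N; rewrite -leNgt.
  by have := series_le Sb; rewrite -/S -(fineK Sfin) lee_fin; lra.
exists M => N.
have tail : \sum_(k < N | (M <= k)%N) ((delta k.+1)%:R^-1 : R) + psum M
    <= psum (maxn M N).
  elim: N => [|N IHN]; first by rewrite big_ord0 add0r maxn0.
  rewrite big_mkcond big_ord_recr -big_mkcond /=.
  have [MN|NM] := leqP M N; last first.
    by move: IHN; rewrite addr0 !(maxn_idPl _) // ltnW.
  move: IHN; rewrite (maxn_idPr MN) (maxn_idPr (leqW MN)) big_ord_recr /=.
  by rewrite addrAC lerD2r.
by have := Sle (maxn M N); lra.
Qed.

(** Borel-Cantelli: a [None] at stage j has mass below 1 / delta, and the tails of the convergent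
    series are small. *)
Lemma thin_not_eventually_some e :
  (\sum_(1 <= n <oo) ((delta n)%:R^-1 : R)%:E < +oo)%E -> 0 < e ->
  thin e [set c | ~ exists N, forall n, (N <= n)%N -> isSome (c n)].
Proof.
move=> Hoo e0; have [M HM] := psum_tail Hoo e0.
apply: (@thin_subset _ _ _ _ [set c | exists j,
    [/\ (M <= j)%N, c j = None & pre c j \in [set: tvertex delta j]%SET]]).
  move=> c /= H; apply: contrapT => H'; apply: H; exists M => n Mn.
  case E: (c n) => [//|]; by exfalso; apply: H'; exists n; split=> //; rewrite inE.
apply: (thin_stages (G := fun j => [set: tvertex delta j]%SET)) => N.
apply: le_trans (HM N); apply: ler_sum => j _.
rewrite /frac cardsT divff; last exact: card_neq0.
rewrite mul1r lef_pV2 ?posrE ?ltr0n //; last by have := delta_ge2 j; lia.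
by rewrite ler_nat.
Qed.

Lemma frac_thinned (S : pred nat) M :
  \prod_(k < M) (if S k then (delta k.+1)%:R / (delta k.+1).+1%:R else 1)
  <= (1 + \sum_(k < M | S k) ((delta k.+1)%:R^-1 : R))^-1.
Proof.
pose t k : R := if S k then (delta k.+1)%:R^-1 else 0.
have t0 k : 0 <= t k by rewrite /t; case: ifP => //; rewrite invr_ge0.
have -> : \sum_(k < M | S k) (delta k.+1)%:R^-1 = \sum_(k < M) t k by rewrite big_mkcond.
rewrite -[leRHS]mul1r ler_pdivlMr; last first.
  by rewrite ltr_pwDl // sumr_ge0.
apply: le_trans (prod_inv_le M t0); rewrite ler_wpM2r //.
  by rewrite addr_ge0 // sumr_ge0.
by apply: ler_prod => k _; rewrite /t; case: ifP => _;
  rewrite ?addr0 ?invr1 ?ler01 //= -delta_inv // lexx divr_ge0.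
Qed.

(* Discarding the other stages costs at most [m + 2] in the sum of 1 / delta, so
   restricting to these keeps a divergent sum divergent. *)
Definition slow_stage m k := (m <= k)%N && (delta k.+1 < 2 ^ (k - m))%N.

Lemma slow_stages_unbounded m :
  (forall b, exists N, b <= psum N) ->
  forall b, exists N, b <= \sum_(k < N | slow_stage m k) ((delta k.+1)%:R^-1 : R).
Proof.
move=> H b; have [N HN] := H (b + (m%:R + 2)); exists N.
have rest : \sum_(k < N | ~~ slow_stage m k) ((delta k.+1)%:R^-1 : R) <= m%:R + 2.
  (* Discarded stages k >= m have 1 / delta <= 2^-(k - m), at most 2 in total; stages below m
     contribute at most 1 each. *)
  apply: le_trans (_ : \sum_(k < N) (if (m <= k)%N then (2 ^+ (k - m))^-1 else 1) <= _).
    rewrite big_mkcond; apply: ler_sum => k _.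
    case: ifP => [|_]; last by case: ifP => // _; rewrite invr_ge0 exprn_ge0.
    have d0 : (0 < delta k.+1)%N by have := delta_ge2 k; lia.
    rewrite /slow_stage negb_and; case: (leqP m k) => mk /=; last first.
      by move=> _; rewrite invf_le1 ?ltr0n // ler1n.
    by rewrite -leqNgt => dk; rewrite lef_pV2 ?posrE ?ltr0n ?exprn_gt0 // -natrX ler_nat.
  (* The right-hand side is the exact value of the sum, which makes the induction go through. *)
  suff : \sum_(k < N) (if (m <= k)%N then (2 ^+ (k - m))^-1 else 1)
      <= (minn m N)%:R + 2 - 2 / 2 ^+ (N - m) :> R.
    move=> /le_trans; apply; have : (minn m N)%:R <= m%:R :> R by rewrite ler_nat geq_minl.
    have : 0 <= 2 / 2 ^+ (N - m) :> R by rewrite divr_ge0 // exprn_ge0.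
    lra.
  elim: (N) => [|n IHn].
    by rewrite big_ord0 minn0 sub0n expr0 divr1 add0r subrr.
  rewrite big_ord_recr /=; apply: le_trans (lerD IHn (lexx _)) _.
  case: (leqP m n) => mn.
    rewrite (minn_idPl (leqW mn)) subSn // exprS invfM.
    set t := (2 ^+ (n - m))^-1; lra.
  rewrite (minn_idPr mn) -natr1.
  have [-> ->] : ((n - m)%N = 0%N /\ (n.+1 - m)%N = 0%N) by split; lia.
  by rewrite expr0; lra.
move: HN; rewrite (bigID (fun k : 'I_N => slow_stage m k)) /=; lra.
Qed.

Lemma small_inv (b e : R) : 0 < e -> e^-1 <= b -> (1 + b)^-1 <= e.
Proof.
move=> e0 eb; have ei : 0 < e^-1 by rewrite invr_gt0.
by rewrite -[leRHS]invrK lef_pV2 ?posrE //; lra.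
Qed.

Lemma thin_no_slow_none m e :
  (\sum_(1 <= n <oo) ((delta n)%:R^-1 : R)%:E = +oo)%E -> 0 < e ->
  thin e [set c | ~ exists k, slow_stage m k /\ c k = None].
Proof.
move=> /psum_unbounded/(slow_stages_unbounded m) H e0; have [M HM] := H e^-1.
pose p k (i : option 'I_(delta k.+1)) := slow_stage m k ==> isSome i.
apply: (@thin_subset _ _ _ _ [set c | forall k, (k < M)%N -> p k (c k)]).
  move=> c /= cN k _; apply/implyP => sk; case E: (c k) => [//|].
  by exfalso; apply: cN; exists k.
apply: thin_box; apply: le_trans (small_inv e0 HM).
rewrite frac_box; apply: le_trans (frac_thinned (slow_stage m) M).
apply: ler_prod => k _; rewrite divr_ge0 //=; rewrite /p; case: ifP => _ /=.
  by rewrite card_isSome.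
by rewrite card_option card_ord divff ?pnatr_eq0.
Qed.

(** A prescribed [Some] has mass delta / (delta + 1), a prescribed [None] only 1 / (delta + 1), so
    no pattern is more likely than the one with [Some] everywhere. *)
Lemma frac_same_levels (y : address) k n : (k <= n)%N ->
  frac R (box (fun i (o : option 'I_(delta i.+1)) =>
    (i < k)%N ==> (isSome o == isSome (y i))) n) <= (1 + psum k)^-1.
Proof.
move=> kn; rewrite frac_box.
apply: le_trans (_ : \prod_(i < n) (if (i < k)%N then
   (delta i.+1)%:R / (delta i.+1).+1%:R else 1) <= _).
  apply: ler_prod => i _; rewrite divr_ge0 //=; case: ifP => _ /=; last first.
    by rewrite card_option card_ord divff ?pnatr_eq0.
  rewrite ler_wpM2r ?invr_ge0 // ler_nat; case: (isSome (y i)).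
    by rewrite (eq_card (B := [pred o | isSome o])) ?card_isSome // => -[].
  rewrite (eq_card (B := pred1 None)) ?card1; first by have := delta_ge2 i; lia.
  by case.
rewrite (_ : psum k = \sum_(i < n | (i < k)%N) ((delta i.+1)%:R^-1 : R)).
  exact: (frac_thinned (fun i => i < k)%N n).
by rewrite (big_ord_widen n (fun i => (delta i.+1)%:R^-1) kn).
Qed.

End growth.

(** * Balls around confined addresses *)

Section balls.
Variables (delta : nat -> nat) (a : attachment delta).
Hypothesis a_apo : forall n (i : 'I_(delta n.+1)), apocentric (a i).
Local Notation address := (address delta).
Local Notation address_graph := (address_graph a).

Lemma ball_isoW (G : graph) (o : G) (H : graph) (eta : H) r s : (r <= s)%N ->
  ball_iso o s (ball_root eta s) -> ball_iso o r (ball_root eta r).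
Proof.
move=> rs iso; apply: rooted_iso_trans (rooted_iso_sym (ball_ball o rs)) _.
by apply: rooted_iso_trans (rooted_iso_ball r iso) _; exact: ball_ball.
Qed.

(** One edge leads from the copy of T_m at [c] into that of T_(Md m); iterating r times gives a copy
    that contains the ball of radius r. *)
Fixpoint radius (Md : nat -> nat) r := if r is s.+1 then Md (radius Md s) else 0%N.

Lemma dist_radius Md c r (x : address_graph) : (forall m, confined a m (Md m) c) ->
  dist_le (G := address_graph) r c x -> agree (radius Md r) x c.
Proof.
move=> cM; elim: r x => [|r IHr] x; first by move=> /dist_le0_eq<-.
move=> /dist_leSr_inv[/IHr|[y /IHr yc yx]].
  by apply: agreeW; exact: confined_leq (cM _).
exact: confined_adj (cM _) yc yx.
Qed.

Lemma ball_pre Md c r n : (forall m, confined a m (Md m) c) ->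
  (radius Md r <= n)%N ->
  ball_iso (G := tree a n) (pre c n) r (ball_root (c : address_graph) r).
Proof.
move=> cM rn; pose f (v : tree a n) : address_graph := ins v c.
have fc : f (pre c n) = c by exact: ins_pre.
suff : ball_iso (G := tree a n) (pre c n) r (ball_root (f (pre c n)) r) by rewrite fc.
apply: ball_iso_embedding.
- by move=> v w /(congr1 (fun x => pre x n)); rewrite !preK.
- by move=> v w; exact: adj_ins.
- move=> y; rewrite fc => /(dist_radius cM) yc; exists (pre y n).
  by apply: ins_pre; exact: agreeW yc.
Qed.

Lemma ball_finite Md c r : (forall m, confined a m (Md m) c) ->
  finite_set [set y | dist_le (G := address_graph) r c y].
Proof.
move=> cM; pose n := radius Md r.
apply: (@sub_finite_set _ _ ((fun v : tvertex delta n => ins v c) @` setT)).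
  by move=> y /(dist_radius cM) yc; exists (pre y n) => //; exact: ins_pre.
by apply: finite_image; exact: finite_finset.
Qed.

Lemma ball_same_pre Md c d r n : (forall m, confined a m (Md m) c) ->
  (forall m, confined a m (Md m) d) -> (radius Md r <= n)%N -> pre c n = pre d n ->
  ball_iso (c : address_graph) r (ball_root (d : address_graph) r).
Proof.
move=> cM dM rn cd; apply: rooted_iso_trans (rooted_iso_sym (ball_pre cM rn)) _.
by rewrite cd; exact: ball_pre dM rn.
Qed.

Definition cover (B : forall n, {set tvertex delta n}) :=
  [set c : address | exists n, pre c n \in B n].

(** [Md] does not depend on [c], so off the cover a ball of radius r is determined by a prefix of
    fixed length. *)
Definition uniformly_confined B Md :=
  forall c, ~ cover B c -> forall m, confined a m (Md m) c.

(** The complement of a cover is closed, so a cluster point stays outside it, and there the balls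
    depend only on prefixes. *)
Lemma limit_point B Md (G : graph) (o : G) (s : nat -> address) :
  uniformly_confined B Md -> (forall r, ~ cover B (s r)) ->
  (forall r, ball_iso o r (ball_root (s r : address_graph) r)) ->
  exists c, [/\ ~ cover B c,
    forall r, ball_iso o r (ball_root (c : address_graph) r)
    & forall n, exists r, pre (s r) n = pre c n].
Proof.
move=> BM sB sP; have [c cP] := address_cluster s.
have cB : ~ cover B c.
  by move=> [n cn]; have [r _ rn] := cP n; apply: (sB r); exists n; rewrite rn.
exists c; split=> // [r|n]; last by have [r _ rn] := cP n; exists r.
have [t rt tn] := cP (maxn (radius Md r) r).
have := ball_isoW (leq_trans (leq_maxr _ _) rt) (sP t).
move=> /rooted_iso_trans; apply.
by apply: (@ball_same_pre Md _ _ _ (maxn (radius Md r) r)) tn;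
  [exact: BM|exact: BM|exact: leq_maxl].
Qed.

Lemma in_component_tail c (y : address_graph) :
  in_component (c : address_graph) y <-> tail_eq y c.
Proof.
split=> [[r /dist_tail]|/tail_eq_sym/(tail_dist a_apo)//].
exact: tail_eq_sym.
Qed.

Lemma represents_local_iso B Md (G : graph) (o : G) c :
  uniformly_confined B Md -> connected_graph G -> ~ cover B c ->
  (forall r, ball_iso o r (ball_root (c : address_graph) r)) ->
  exists2 f : G -> address_graph, represents c f & f o = c.
Proof.
move=> BM Gc cB iso.
have [f [fo fi fa fc]] := local_iso_component iso (fun r => ball_finite r (BM c cB)).
have oG u : in_component o u by exact: Gc.
exists f => //; split; first by move=> u v; exact: fi.
  by move=> u v; exact: fa.
move=> x; rewrite -in_component_tail fc; split=> [[u _ ux]|[u ux]]; by exists u.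
Qed.

End balls.

(** * Transfer to the Benjamini-Schramm limit *)

Section transfer.
Variables (R : realType) (delta : nat -> nat).
Hypothesis delta_ge2 : forall n, (2 <= delta n.+1)%N.
Variable a : attachment delta.
Hypothesis a_apo : forall n (i : 'I_(delta n.+1)), apocentric (a i).
Variable P : random_rooted_graph R.
Hypothesis P_limit : is_BS_limit (tree a) P.
Local Notation address := (address delta).
Local Notation address_graph := (address_graph a).

Definition ball_event (H : graph) (eta : H) r : set rooted_graph_space :=
  [set x | ball_iso (underlying_root x) r (ball_root eta r)].

Lemma local_open_measurable (A : set rooted_graph_class) :
  local_open A -> measurable (A : set rooted_graph_space).
Proof. by move=> oA; exact: sub_sigma_algebra. Qed.

Lemma ball_event_open (H : graph) (eta : H) r : local_open (ball_event eta r).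
Proof.
move=> x xr; exists r => y xy.
exact: rooted_iso_trans (rooted_iso_sym xy) xr.
Qed.

Lemma ball_event_measurable (H : graph) (eta : H) r : measurable (ball_event eta r).
Proof. apply: local_open_measurable; exact: ball_event_open. Qed.

Definition tree_event (H : graph) (T : eqType) (o : T -> H) (s : seq T) r n :
    {set tvertex delta n} :=
  [set v | `[< exists2 t, t \in s &
     ball_iso (G := tree a n) v r (ball_root (o t) r) >]]%SET.

Lemma uniform_ball_probE n r (H : graph) (eta : H) :
  uniform_ball_prob R (tree a n) r eta =
  frac R [set v : tvertex delta n | `[< ball_iso (G := tree a n) v r eta >]]%SET.
Proof.
rewrite /uniform_ball_prob /frac; congr (_%:R / _); apply: eq_card => v.
rewrite [RHS]inE; apply/idP/idP => [/asboolP/=|vb]; first by [].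
by apply/asboolP.
Qed.

(** The limit hypothesis concerns one ball at a time. A ball that occurs again in the list adds
    nothing; otherwise its event is disjoint from the others and the limits add up. *)
Lemma ball_events_limit (H : graph) (T : eqType) (o : T -> H) (s : seq T) r :
  (fun n => (frac R (tree_event o s r n))%:E) @ \oo -->
    P (\bigcup_(t in [set` s]) ball_event (o t) r).
Proof.
elim: s => [|t s IHs].
  rewrite (_ : \bigcup_(_ in _) _ = set0) ?measure0; last first.
    by rewrite -subset0 => x [t /=]; rewrite in_nil.
  rewrite (_ : (fun n => _) = cst 0%E); first exact: cvg_cst.
  apply/funext => n; rewrite (_ : tree_event _ _ _ _ = finset.set0) ?frac_set0 //.
  by apply/setP => v; rewrite !inE; apply/asboolP => -[].
have [[u us tu]|nts] := pselect (exists2 u, u \in s &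
    rooted_iso (ball_root (o t) r) (ball_root (o u) r)).
  rewrite (_ : \bigcup_(_ in _) _ = \bigcup_(t in [set` s]) ball_event (o t) r).
    rewrite (_ : (fun n => _) = (fun n => (frac R (tree_event o s r n))%:E)) //.
    apply/funext => n; congr (frac R _)%:E; apply/setP => v; rewrite !inE.
    apply: asbool_equiv_eq; split=> [[w]|[w ws vw]]; last by exists w => //; rewrite inE ws orbT.
    rewrite inE => /orP[/eqP->|ws] vw; last by exists w.
    by exists u => //; exact: rooted_iso_trans vw tu.
  apply/seteqP; split=> x [w /= ws xw]; last by exists w => //=; rewrite inE ws orbT.
  move: ws xw; rewrite inE => /orP[/eqP->|ws] vw; last by exists w.
  by exists u => //; exact: rooted_iso_trans vw tu.
have -> : \bigcup_(u in [set` t :: s]) ball_event (o u) r =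
    ball_event (o t) r `|` \bigcup_(u in [set` s]) ball_event (o u) r.
  apply/seteqP; split=> x.
    by move=> [u /=]; rewrite inE => /orP[/eqP->|us] xu; [left|right; exists u].
  by move=> [xt|[u /= us xu]]; [exists t|exists u] => //=; rewrite inE ?eqxx ?us ?orbT.
rewrite measureU; last 3 first.
- exact: ball_event_measurable.
- apply: local_open_measurable => x [u us xu]; exists r => y xy; exists u => //.
  exact: rooted_iso_trans (rooted_iso_sym xy) xu.
- rewrite -subset0 => x [xt [u /= us xu]]; apply: nts; exists u => //.
  exact: rooted_iso_trans (rooted_iso_sym xt) xu.
rewrite (_ : (fun n => _) = (fun n =>
  (uniform_ball_prob R (tree a n) r (ball_root (o t) r))%:E
   + (frac R (tree_event o s r n))%:E)%E); last first.
  apply/funext => n; rewrite -EFinD; congr (_%:E).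
  pose X := [set v : tvertex delta n |
    `[< ball_iso (G := tree a n) v r (ball_root (o t) r) >]]%SET.
  rewrite (uniform_ball_probE n r (ball_root (o t) r)) -/X.
  have -> : tree_event o (t :: s) r n = (X :|: tree_event o s r n)%SET.
    apply/setP => v; rewrite !inE -asbool_or; apply: asbool_equiv_eq.
    split; first by move=> [u]; rewrite inE => /orP[/eqP->|us] vu; [left|right; exists u].
    by move=> [vt|[u us vu]]; [exists t|exists u] => //; rewrite inE ?eqxx ?us ?orbT.
  apply: frac_setU_disjoint; apply/setP => v; rewrite !inE -asbool_and.
  apply/asboolP => -[vt [u us vu]]; apply: nts; exists u => //.
  exact: rooted_iso_trans (rooted_iso_sym vt) vu.
apply: cvgeD IHs; last exact: P_limit.
by rewrite ge0_adde_def // inE.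
Qed.

Definition covered_ball (B : forall n, {set tvertex delta n}) r :
    set rooted_graph_space :=
  [set x | exists c : address_graph,
     ~ cover B c /\ ball_iso (underlying_root x) r (ball_root c r)].

Lemma covered_ball_open B r : local_open (covered_ball B r).
Proof.
move=> x [c [cB xc]]; exists r => y xy; exists c; split=> //.
exact: rooted_iso_trans (rooted_iso_sym xy) xc.
Qed.

Lemma covered_ball_measurable B r : measurable (covered_ball B r).
Proof. apply: local_open_measurable; exact: covered_ball_open. Qed.

(** The event is a finite union of ball events, one for each prefix of length n that extends outside
    the cover. By [thin_count], at most a fraction e of the vertices of T_N have all their
    extensions in the cover, and the others already have one of these balls in T_N. *)
Lemma covered_ball_prob B Md r e : uniformly_confined a B Md ->
  @thin R delta e (cover B) -> ((1 - e)%:E <= P (covered_ball B r))%E.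
Proof.
move=> BM Be; pose n := radius Md r.
have /choice[w wP] : forall v : tvertex delta n, exists c : address_graph,
    (exists2 d, ~ cover B d & pre d n = v) -> ~ cover B c /\ pre c n = v.
  move=> v; have [[d dB dv]|nv] := pselect (exists2 d, ~ cover B d & pre d n = v).
    by exists d.
  by exists (none_address delta).
pose s := [seq v <- enum (tvertex delta n) | `[< exists2 d, ~ cover B d & pre d n = v >]].
have -> : covered_ball B r = \bigcup_(v in [set` s]) ball_event (w v) r.
  apply/seteqP; split=> x.
    move=> [c [cB xc]]; have cv : exists2 d, ~ cover B d & pre d n = pre c n by exists c.
    have [wB wE] := wP _ cv.
    exists (pre c n); first by rewrite /= mem_filter mem_enum andbT; apply/asboolP.
    apply: rooted_iso_trans xc _.
    exact: (ball_same_pre a_apo (BM c cB) (BM _ wB) (leqnn _) (esym wE)).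
  move=> [v /=]; rewrite mem_filter mem_enum andbT => /asboolP /wP[wB wv] xv.
  by exists (w v).
have Hlim := @ball_events_limit _ _ w s r.
rewrite -(cvg_lim _ Hlim) //; apply: lime_ge; first by apply/cvg_ex; eexists; exact: Hlim.
exists n => // N /= nN; rewrite lee_fin.
have := thin_count N Be; set W := [set _ | _]%SET => We.
apply: le_trans (_ : frac R (~: W)%SET <= _); first by rewrite frac_setC; lra.
apply: frac_le; apply/fintype.subsetP => v; rewrite finset.in_setC !inE => /asboolPn.
move=> /existsNP[c /not_implyP[cv cB]].
have cv' : exists2 d, ~ cover B d & pre d n = pre c n by exists c.
have [wB wE] := wP _ cv'.
exists (pre c n); first by rewrite mem_filter mem_enum andbT; apply/asboolP.
rewrite -cv; apply: rooted_iso_trans (ball_pre a_apo (BM c cB) nN) _.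
exact: (ball_same_pre a_apo (BM c cB) (BM _ wB) (leqnn _) (esym wE)).
Qed.

Lemma covered_balls_prob B Md e : uniformly_confined a B Md ->
  @thin R delta e (cover B) -> (P (~` \bigcap_r covered_ball B r) <= e%:E)%E.
Proof.
move=> BM Be; rewrite setC_bigcap.
have mF r : measurable (~` covered_ball B r).
  by apply: measurableC; exact: covered_ball_measurable.
have mono : nondecreasing_seq (fun r => ~` covered_ball B r).
  move=> r s rs; apply/subsetPset => x xr [c [cB xs]]; apply: xr; exists c.
  by split=> //; exact: ball_isoW xs.
have Hlim := nondecreasing_cvg_mu (mu := P) mF (bigcup_measurable (fun r _ => mF r)) mono.
rewrite -(cvg_lim _ Hlim) //; apply: lime_le; first by apply/cvg_ex; eexists; exact: Hlim.
apply: nearW => r /=; rewrite probability_setC; last exact: covered_ball_measurable.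
rewrite leeBlDr; last by rewrite fin_num_measure //; exact: covered_ball_measurable.
apply: le_trans (leeD2l e%:E (covered_ball_prob r BM Be)).
by rewrite -EFinD lee_fin; lra.
Qed.

Definition null_set (A : set address) := forall e : R, 0 < e -> @thin R delta e A.

Lemma null_bigcup (A : nat -> set address) :
  (forall k, null_set (A k)) -> null_set (\bigcup_k A k).
Proof.
move=> nA e e0; apply: thin_bigcup; first exact: ltW.
by move=> k; apply: nA; rewrite divr_gt0 // exprn_gt0.
Qed.

(** Half of e goes to [A], and e / 2^(m + 2) to the failure of confinement at each m. *)
Lemma good_cover A e : null_set A -> 0 < e -> exists B Md,
  [/\ uniformly_confined a B Md, @thin R delta e (cover B) & A `<=` cover B].
Proof.
move=> nA e0; have e2 : 0 < e / 2 by rewrite divr_gt0.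
have /choice[Md HM] : forall m, exists M,
    @thin R delta (e / 2 / 2 ^+ m.+1) [set c | ~ confined a m M c].
  by move=> m; apply: (thin_unconfined delta_ge2); rewrite divr_gt0 // exprn_gt0.
have := thin_setU (nA _ e2) (thin_bigcup (ltW e2) HM); rewrite -splitr.
move=> [B [AB Be]]; exists B, Md; split.
- move=> c cB m; apply: contrapT => nc; apply: cB; apply: AB; right.
  by exists m.
- by exists B; split.
- by move=> c Ac; apply: AB; left.
Qed.

(** If all balls of [x] occur off one cover, compactness yields a single address with the same
    balls, whose component is then isomorphic to [x]. The exceptional graphs fail this for covers of
    mass 1 / (k + 1), for every k. *)
Lemma ae_represented A : null_set A ->
  {ae P, forall x, exists2 c, ~ A c & tame a c /\
    exists2 f : underlying x -> address_graph,
      represents c f & f (underlying_root x) = c}.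
Proof.
move=> nA.
have /choice[B HB] : forall k, exists B, exists Md,
    [/\ uniformly_confined a B Md, @thin R delta k.+1%:R^-1 (cover B) & A `<=` cover B].
  by move=> k; apply: good_cover => //; rewrite invr_gt0.
pose N := \bigcap_k ~` \bigcap_r covered_ball (B k) r.
have mN k : measurable (~` \bigcap_r covered_ball (B k) r).
  apply: measurableC; apply: bigcap_measurable; first by exists 0%N.
  by move=> r _; exact: covered_ball_measurable.
exists N; split.
- by apply: bigcap_measurable => [|k _]; [exists 0%N|exact: mN].
- apply/eqP; rewrite eq_le measure_ge0 andbT; apply/lee_addgt0Pr => e e0.
  rewrite add0e.
  have [k ke] : exists k, k.+1%:R^-1 < e.
    have /cvgrPdist_lt /(_ e e0)[k _ Hk] := @cvg_harmonic R.
    exists k; have := Hk k (leqnn k); rewrite /= sub0r normrN ger0_norm //.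
  have [Md [BM Be AB]] := HB k.
  apply: le_trans (_ : (P (~` \bigcap_r covered_ball (B k) r) <= _)%E).
    apply: le_measure; rewrite ?inE; [|exact: mN|].
      by apply: bigcap_measurable => [|j _]; [exists 0%N|exact: mN].
    by move=> x; apply.
  by apply: le_trans (covered_balls_prob BM Be) _; rewrite lee_fin ltW.
- move=> x nx k _ xk; apply: nx.
  have [Md [BM Be AB]] := HB k.
  have /choice[s sP] : forall r, exists c : address, ~ cover (B k) c /\
     ball_iso (underlying_root x) r (ball_root (c : address_graph) r).
    by move=> r; have [c cP] := xk r I; exists c.
  have [c [cB xc _]] := limit_point a_apo BM (fun r => (sP r).1) (fun r => (sP r).2).
  have [f fr fx] := represents_local_iso a_apo BM (@rg_connected (class_rep x)) cB xc.
  exists c; first by move=> Ac; apply: cB; exact: AB.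
  split; last by exists f.
  by move=> m; exists (Md m); exact: BM.
Qed.

End transfer.

(** * Slow growth: no atoms *)

Section dead_ends.
Variables (delta : nat -> nat) (a : attachment delta).
Hypothesis delta_ge2 : forall n, (2 <= delta n.+1)%N.
Hypothesis a_apo : forall n (i : 'I_(delta n.+1)), apocentric (a i).
Local Notation address := (address delta).

(* Fewer than 2^(k-m) edges are attached to T_k, so they miss one of its
   apocentric copies of T_m. *)
Lemma dead_end_exists m k (c : address) : slow_stage delta m k -> c k = None ->
  exists2 z, tail_eq z c & dead_end a m z.
Proof.
move=> /andP[mk dk] ck.
(* [box p k] is the set of centers of the apocentric copies of T_m in T_k, at least 2^(k - m) in
   number; [g i] is the center of the copy containing [a i]. *)
pose p j (i : option 'I_(delta j.+1)) := if (j < m)%N then i == None else isSome i.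
pose g (i : 'I_(delta k.+1)) : tvertex delta k :=
  pre (ins (Defs.center delta m) (ins (a i) (none_address delta))) k.
have [v vp vg] : exists2 v, v \in box p k & v \notin [set g i | i : 'I_(delta k.+1)]%SET.
  apply: contrapT => H; have : (2 ^ (k - m) <= delta k.+1)%N; last by rewrite leqNgt dk.
  apply: leq_trans (_ : #|box p k| <= _)%N.
    rewrite card_box; move: (k) mk; elim=> [|n IHn].
      by rewrite leqn0 => /eqP->; rewrite subnn big_ord0.
    rewrite leq_eqVlt => /orP[/eqP mn|].
      rewrite mn subnn; apply: prodn_gt0 => j; rewrite /p mn (ltn_ord j).
      by apply/card_gt0P; exists None.
    rewrite ltnS => mn; rewrite big_ord_recr /= subSn // expnSr leq_mul ?IHn //.
    have nm : (n < m)%N = false by lia.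
    have -> : #|p n| = delta n.+1; last exact: delta_ge2.
    by rewrite -[RHS](card_isSome delta n) /p nm.
  rewrite -[X in (_ <= X)%N]card_ord -cardsT.
  apply: leq_trans (leq_imset_card g _); apply/subset_leq_card/fintype.subsetP => v vp.
  apply: contrapT => /negP vg; apply: H; exists v => //.
  by apply: contra vg => /imsetP[i _ ->]; apply: imset_f; rewrite inE.
pose z := ins v c.
have zv : pre z k = v by exact: preK.
have zc : agree k z c by exact: ins_agree.
have zp j : (j < k)%N -> if (j < m)%N then z j = None else isSome (z j).
  move: vp; rewrite -zv => /box_pre /(_ j) + jk => /(_ jk); rewrite /p.
  by case: ifP => // _ /eqP.
have z0 j : (j < m)%N -> z j = None.
  by move=> jm; have := zp j (leq_trans jm mk); rewrite jm.
have zS j : (m <= j < k)%N -> isSome (z j).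
  by move=> /andP[mj jk]; have := zp j jk; rewrite ltnNge mj.
exists z; first by exists k.
have zdep : dep m z = 0%N by apply/dep_eq0.
(* Every descendant of [z] stays in its copy of T_m, where depths are below 2^m. *)
split=> // z' z'z.
have : agree m z' z; last by move=> /(anc_dep a_apo z'z); have := dep_lt m z'; lia.
elim: (2 ^ m)%N z' z'z => [|h IHh] z'; first by move=> /= ->.
move=> [y [l z'y] /IHh yz].
have [lm|ml] := ltnP l m.
  by apply: agree_trans yz; apply/(par_at_agree m z'y).
exfalso; have yS := par_at_some a_apo z'y; case: z'y => i [_ yl _ ya _].
have zl : z l = None by rewrite -yz.
(* A child attached at stage l >= m is excluded: for l < k the copy is not central, for l > k an
   apocentric parent contradicts [c k = None], and for l = k the copy was chosen to miss all
   attachment vertices. *)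
have [lk|kl|lk] := ltngtP l k.
- by have := zS l; rewrite ml lk zl => /(_ isT).
- by have := yS k kl; rewrite yz // zc // ck.
subst l; move: vg => /negP; apply; apply/imsetP; exists i => //.
rewrite -zv; apply/eq_pre => j jk; have [jm|mj] := ltnP j m.
  by rewrite z0 // ((pre_center m _).1 (preK (Defs.center delta m) _)).
rewrite ins_agree // -yz //.
by move: j jk {mj}; apply/eq_pre; rewrite preK.
Qed.

Lemma leafy_slow (c : address) :
  (forall m, exists k, slow_stage delta m k /\ c k = None) -> leafy a c.
Proof. by move=> H m; have [k [mk ck]] := H m; exact: dead_end_exists mk ck. Qed.

End dead_ends.

Section atoms.
Variables (R : realType) (delta : nat -> nat).
Hypothesis delta_ge2 : forall n, (2 <= delta n.+1)%N.
Variable a : attachment delta.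
Hypothesis a_apo : forall n (i : 'I_(delta n.+1)), apocentric (a i).
Variable P : random_rooted_graph R.
Hypothesis P_limit : is_BS_limit (tree a) P.
Local Notation address := (address delta).
Local Notation address_graph := (address_graph a).
Hypothesis slow : (\sum_(1 <= n <oo) ((delta n)%:R^-1 : R)%:E = +oo)%E.

Definition non_slow : set address :=
  \bigcup_m [set c | ~ exists k, slow_stage delta m k /\ c k = None].

Lemma non_slow_null : null_set R non_slow.
Proof. by apply: null_bigcup => m e e0; exact: thin_no_slow_none. Qed.

Lemma slowP c : ~ non_slow c ->
  forall m, exists k, slow_stage delta m k /\ c k = None.
Proof. by move=> ns m; apply: contrapT => H; apply: ns; exists m. Qed.

(** Otherwise addresses with ever larger balls like those of [y], but another pattern, cluster at an
    address whose rooted tree is isomorphic to that of [y]; by [iso_dep] it has the pattern of [y],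
    a contradiction. *)
Lemma same_levels B Md (y : address_graph) k : uniformly_confined a B Md ->
  non_slow `<=` cover B -> tame a y -> leafy a y ->
  exists r, forall c : address_graph, ~ cover B c ->
    ball_iso c r (ball_root y r) -> forall i, (i < k)%N -> isSome (c i) = isSome (y i).
Proof.
move=> BM nsB yt yl; apply: contrapT => /forallNP H.
have /choice[s sP] : forall r, exists c : address, [/\ ~ cover B c,
    ball_iso (c : address_graph) r (ball_root y r)
    & ~ forall i, (i < k)%N -> isSome (c i) = isSome (y i)].
  move=> r; have /existsNP[c] := H r.
  by move=> /not_implyP[cB /not_implyP[cy ck]]; exists c.
have sB r : ~ cover B (s r) by have [] := sP r.
have sy r : ball_iso y r (ball_root (s r : address_graph) r).
  by have [_ sr _] := sP r; exact: rooted_iso_sym.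
have [c [cB yc cs]] := limit_point a_apo BM sB sy.
have cM := BM c cB; have ct : tame a c by move=> m; exists (Md m).
have [f [fy fi fa fc]] := local_iso_component yc (fun r => ball_finite a_apo r cM).
have [r rk] := cs k; have [_ _] := sP r; apply => i ik.
have /eq_pre -> // := rk.
rewrite -fy; apply: dep_inj ik.
apply: (iso_dep _ a_apo (x0 := y) (c := c)) => //; last exact: tail_eq_refl.
- by move=> n; have := delta_ge2 n; lia.
- move=> u v /(in_component_tail a_apo) uy /(in_component_tail a_apo) vy; exact: fi.
- move=> u v /(in_component_tail a_apo) uy /(in_component_tail a_apo) vy; exact: fa.
- move=> w; rewrite -(in_component_tail a_apo) fc.
  by split=> -[u /(in_component_tail a_apo) uy fu]; exists u.
Qed.

(** A vertex of T_n with the r-ball of [y] either has all its extensions in the cover or shares the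
    first k levels of [y]; each case has mass at most e / 2. *)
Lemma atom_null (y : address_graph) : tame a y -> leafy a y ->
  P.-negligible (\bigcap_r ball_event y r).
Proof.
move=> yt yl; have mE : measurable (\bigcap_r ball_event y r).
  apply: bigcap_measurable; first by exists 0%N.
  by move=> r _; exact: ball_event_measurable.
exists (\bigcap_r ball_event y r); split=> //.
apply/eqP; rewrite eq_le measure_ge0 andbT; apply/lee_addgt0Pr => e e0.
rewrite add0e; have e2 : 0 < e / 2 by rewrite divr_gt0.
have [B [Md [BM Be nsB]]] := good_cover delta_ge2 a non_slow_null e2.
have [k Hk] := psum_unbounded slow (e / 2)^-1.
have [r Hr] := same_levels k BM nsB yt yl.
apply: (@le_trans _ _ (P (ball_event y r))).
  by apply: le_measure; rewrite ?inE //; [exact: ball_event_measurable|move=> x; apply].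
have Hlim := @P_limit _ (ball_root y r) r.
rewrite -(cvg_lim _ Hlim) //; apply: lime_le; first by apply/cvg_ex; eexists; exact: Hlim.
exists (maxn k (radius Md r)) => // n /= nkM; rewrite lee_fin uniform_ball_probE.
have kn : (k <= n)%N by apply: leq_trans nkM; exact: leq_maxl.
have rn : (radius Md r <= n)%N by apply: leq_trans nkM; exact: leq_maxr.
have := thin_count n Be; set W := [set _ | _]%SET => We.
have := frac_same_levels R delta_ge2 y kn; set V := box _ n => Ve.
apply: le_trans (_ : frac R (W :|: V)%SET <= _).
  apply: frac_le; apply/fintype.subsetP => v; rewrite inE => /asboolP vy.
  rewrite finset.in_setU; apply/orP; have [vW|vW] := pselect (v \in W); [by left|right].
  have [c cv cB] : exists2 c, pre c n = v & ~ cover B c.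
    apply: contrapT => H; apply: vW; rewrite inE; apply/asboolP => c cv.
    by apply: contrapT => cB; apply: H; exists c.
  rewrite -cv; apply/box_pre => i _; apply/implyP => ik; apply/eqP.
  apply: (Hr c) => //.
  apply: rooted_iso_trans (rooted_iso_sym (ball_pre a_apo (BM c cB) rn)) _.
  by rewrite cv.
apply: le_trans (frac_setU _ _ _) _; rewrite [e]splitr lerD //.
by apply: le_trans Ve _; exact: small_inv.
Qed.

(** Unless the event is already negligible, [G] is the component of a leafy tame address [c0].
    Graphs isomorphic to [G] then differ only by their root, and the component is countable, so the
    event is covered by countably many null events [A n k]. *)
Lemma deterministic_null (G : graph) :
  P.-negligible [set x | graph_iso (underlying x) G].
Proof.
pose Q (x : rooted_graph_space) := exists2 c : address, ~ non_slow c & tame a c /\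
  exists2 f : underlying x -> address_graph, represents c f & f (underlying_root x) = c.
have aeQ : {ae P, forall x, Q x}.
  exact: (ae_represented delta_ge2 a_apo P_limit non_slow_null).
have [[x0 [h0 [h0b h0a]] [c0 c0s [c0t [f0 f0r _]]]]|H] :=
  pselect (exists2 x0, graph_iso (underlying x0) G & Q x0); last first.
  by apply: negligibleS aeQ => x /= xG xQ; apply: H; exists x.
have c0l := leafy_slow delta_ge2 a_apo (slowP c0s).
have [f0i f0a f0c] := f0r; case: h0b => h0' h0K h0'K.
pose E (y : address_graph) := \bigcap_r ball_event y r.
pose A n k := if @unpickle (tvertex delta n) k is Some v then E (ins v c0) else set0.
have AN : P.-negligible (\bigcup_n \bigcup_k A n k).
  apply: negligible_bigcup => n; apply: negligible_bigcup => k; rewrite /A.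
  case: unpickle => [v|]; last exact: negligible_set0.
  have vc : tail_eq (ins v c0) c0 by exists n; exact: ins_agree.
  by apply: atom_null; [exact: tame_tail vc|exact: leafy_tail vc].
apply: negligibleS AN => x [h [[h' hK h'K] ha]].
pose f (u : underlying x) := f0 (h0' (h u)).
have h0'a u v : adj (h0' u) (h0' v) = adj u v by rewrite -h0a !h0'K.
have f_inj : injective f by move=> u v /f0i /(can_inj h0'K) /(can_inj hK).
have f_adj u v : adj (f u) (f v) = adj u v by rewrite f0a h0'a ha.
have f_onto z : tail_eq z c0 -> exists u, f u = z.
  by move=> /f0c[u uz]; exists (h' (h0 u)); rewrite /f h'K h0K.
have ftail u : tail_eq (f u) c0 by apply/f0c; exists (h0' (h u)).
have [n yn] := ftail (underlying_root x).
exists n => //; exists (pickle (pre (f (underlying_root x)) n)) => //.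
rewrite /A pickleK ins_pre // => r _; apply: ball_iso_embedding => // z.
move=> /dist_tail fz; apply: f_onto; apply: tail_eq_trans (tail_eq_sym fz) _.
exact: ftail.
Qed.

End atoms.

Theorem theorem3 (R : realType) (delta : nat -> nat)
    (delta_ge2 : forall n, (1 <= n)%N -> (2 <= delta n)%N)
    (a : attachment delta) (a_trees : associated_trees a)
    (P : random_rooted_graph R) (P_limit : is_BS_limit (tree a) P) :
  [/\ (\sum_(1 <= n <oo) ((delta n)%:R^-1 : R)%:E < +oo)%E ->
        {ae P, forall x, apocentric_limit a (underlying x)},
      (\sum_(1 <= n <oo) ((delta n)%:R^-1 : R)%:E = +oo)%E ->
        {ae P, forall x, mixed_limit a (underlying x)} /\
        (forall G : graph, is_tree G ->
          P.-negligible [set x | graph_iso (underlying x) G]) &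
      {ae P, forall x, one_ended (underlying x)}].
Proof.
have [a_apo _] := a_trees.
have d2 n : (2 <= delta n.+1)%N by exact: delta_ge2.
have rep A : null_set R A -> {ae P, forall x, exists2 c, ~ A c & tame a c /\
    exists f : underlying x -> address_graph a, represents c f}.
  move=> /(ae_represented d2 a_apo P_limit); apply: filterS => x [c cA [ct [f fr _]]].
  by exists c => //; split=> //; exists f.
split.
- move=> fast; have := rep _ (fun e => thin_not_eventually_some d2 fast).
  apply: filterS => x [c /contrapT[N cN] [ct [f fr]]].
  (* Changing finitely many coordinates does not change the component; the first N are made
     apocentric. *)
  pose d : address delta := fun n => if (n < N)%N then
    Some (Ordinal (ltnW (d2 n))) else c n.
  have cd : tail_eq c d by exists N => n Nn; rewrite /d ltnNge Nn.
  exists d; split; last exact: represents_limit (represents_tail fr cd).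
  by move=> n; rewrite /d; case: ltnP => // /cN; case: (c n).
- move=> slow; split; last by move=> G _; exact: deterministic_null.
  have := rep _ (non_slow_null d2 slow).
  apply: filterS => x [c /slowP cs [ct [f fr]]].
  exists c; split; last exact: represents_limit fr.
    by move=> N; have [k [/andP[Nk _] ck]] := cs N; exists k.
  by move=> N; have [k Nk ck] := tame_rising ct N; exists k => //; case: (c k) ck.
- have null0 : null_set R (set0 : set (address delta)).
    move=> e e0; exists (fun n => finset.set0); split=> // N.
    by rewrite big1 ?ltW // => n _; exact: frac_set0.
  have := rep _ null0; apply: filterS => x [c _ [ct [f fr]]].
  exact: represents_one_ended fr ct.
Qed.
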